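(* Let $M$ be a Riemannian manifold equipped with a distance function $d\colon M\times M\to\mathbb R_{\ge0}$ that induces the given topology on $M$ and restricts to the geodesic distance on each connected component. Suppose the metric space $(M,d)$ is equipped with a wandering isometric action by a discrete group $G$. For each $p\in M$, let the stabilizer $G_p$ act on the tangent space $T_pM$ by the isotropy representation. Then for each $p\in M$, $$c_2(T_pM/G_p)\leq c_2(M/G).$$
   Context: An action of $G$ on $M$ is wandering if each $p\in M$ has an open neighborhood $U\subseteq M$ such that $\{g\in G: g\cdot U\cap U\ne\varnothing\}$ is finite. In this case all $G$-orbits are closed and each stabilizer $G_p:=\{g\in G:g\cdot p=p\}$ is finite. Each $g\in G$ restricts on each connected component to a Riemannian isometry between connected components. The isotropy representation at $p$ is $G_p\to\operatorname{O}(T_pM)$, $g\mapsto d_pg$ (the differential of $g$ at $p$), where $T_pM$ carries the Riemannian inner product. If a group $G$ acts by isometries on a metric space $X$ with closed orbits, the orbit space $X/G$ carries the quotient metric $d([x],[y])=\inf_{p\in[x],\,q\in[y]}d_X(p,q)$, where $[x]=G\cdot x$. For a map $f\colon X\to Y$ of metric spaces, let $\alpha,\beta\in[0,\infty]$ be the largest and smallest constants (respectively) with $\alpha\, d_X(x,x')\le d_Y(f(x),f(x'))\le\beta\, d_X(x,x')$ for all $x,x'\in X$; the distortion of $f$ is $\kappa(f):=\beta/\alpha$, with $\kappa(f)=\infty$ if $\alpha=0$ or $\beta=\infty$. The Euclidean distortion $c_2(X)\in[1,\infty]$ is the infimum of all $c$ for which there exist a Hilbert space $H$ and a map $f\colon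 X\to H$ with $\kappa(f)=c$ (a one-point space is a degenerate case, for which $c_2$ is taken to be $1$). *)

(* Defs.v *)
From HB Require Import structures.
From mathcomp Require Import all_boot all_order all_algebra.
From mathcomp Require Import all_classical all_reals all_analysis.
Set Implicit Arguments.
Unset Strict Implicit.
Unset Printing Implicit Defensive.
Import Order.TTheory GRing.Theory Num.Theory.
Import numFieldNormedType.Exports.
Local Open Scope classical_set_scope.
Local Open Scope ring_scope.

(* For an open set [A], [Ck k A f] says that [f] is of class C^k on [A]: in
   finite dimension, C^k.+1 means Fréchet differentiable with all directional
   derivatives of class C^k. *)
Fixpoint Ck (R : realType) (V W : normedModType R) (k : nat) (A : set V)
    (f : V -> W) : Prop :=
  if k is k'.+1 then
    (forall x, A x -> differentiable f x) /\ (forall v, Ck k' A ('D_v f))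
  else forall x, A x -> {for x, continuous f}.

Definition smooth_on (R : realType) (V W : normedModType R) (A : set V)
    (f : V -> W) : Prop := forall k, Ck k A f.

(* [coord i] and [param i] are total functions; only their restrictions to
   [dom i] and [cod i] matter. The map [chart_at] picks a chart around each
   point: it makes the charts cover [M] and fixes coordinates on tangent
   spaces. The Hausdorff property is not listed, since the manifolds considered
   below are metrized; second countability is not required. *)
Record smooth_atlas (R : realType) (n : nat) (M : topologicalType) :=
  SmoothAtlas {
  chart : Type ;
  dom : chart -> set M ;
  cod : chart -> set 'rV[R]_n ;
  coord : chart -> M -> 'rV[R]_n ;
  param : chart -> 'rV[R]_n -> M ;
  chart_at : M -> chart ;
  dom_open : forall i, open (dom i) ;
  cod_open : forall i, open (cod i) ;
  coord_cod : forall i p, dom i p -> cod i (coord i p) ;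
  param_dom : forall i x, cod i x -> dom i (param i x) ;
  coordK : forall i p, dom i p -> param i (coord i p) = p ;
  paramK : forall i x, cod i x -> coord i (param i x) = x ;
  coord_continuous : forall i p, dom i p -> {for p, continuous (coord i)} ;
  param_continuous : forall i x, cod i x -> {for x, continuous (param i)} ;
  transition_smooth : forall i j,
    smooth_on (cod i `&` param i @^-1` dom j) (coord j \o param i) ;
  chart_atP : forall p, dom (chart_at p) p
}.

(* The tangent space at [p] is ['rV[R]_n], a vector being identified with its
   coordinates in the chart [chart_at p]. The operator ['d] is total: when [f]
   is an isometry fixing [p], its differentiability is a theorem (Myers and
   Steenrod) rather than an assumption. *)
Definition differential (R : realType) (n : nat) (M : topologicalType)
    (A : smooth_atlas R n M) (f : M -> M) (p : M) : 'rV[R]_n -> 'rV[R]_n :=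
  'd (coord (chart_at A (f p)) \o f \o param (chart_at A p))
     (coord (chart_at A p) p).

Definition bilin (R : realType) (n : nat) (S : 'M[R]_n) (v w : 'rV[R]_n) : R :=
  (v *m S *m w^T) ord0 ord0.

(* [gram i x] is the matrix of the metric in the coordinates of chart [i]. *)
Record riemannian_metric (R : realType) (n : nat) (M : topologicalType)
    (A : smooth_atlas R n M) := RiemannianMetric {
  gram : chart A -> 'rV[R]_n -> 'M[R]_n ;
  gram_smooth : forall i, smooth_on (cod i) (gram i) ;
  gram_sym : forall i x, cod i x -> (gram i x)^T = gram i x ;
  gram_posdef : forall i x, cod i x ->
    forall v, v != 0 -> 0 < bilin (gram i x) v v ;
  gram_transition : forall i j x, cod i x -> dom j (param i x) ->
    forall v w, bilin (gram i x) v w =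
      let T := coord j \o param i in
      bilin (gram j (T x)) ('d T x v) ('d T x w)
}.

Definition tangent_norm (R : realType) (n : nat) (M : topologicalType)
    (A : smooth_atlas R n M) (g : riemannian_metric A) (p : M)
    (v : 'rV[R]_n) : R :=
  Num.sqrt (bilin (gram g (chart_at A p) (coord (chart_at A p) p)) v v).

Definition tangent_dist (R : realType) (n : nat) (M : topologicalType)
    (A : smooth_atlas R n M) (g : riemannian_metric A) (p : M)
    (v w : 'rV[R]_n) : R :=
  tangent_norm g p (v - w).

(* Smoothness on the closed interval, as the existence of a smooth extension to
   a neighborhood of it. *)
Definition smooth_arc (R : realType) (n : nat) (M : topologicalType)
    (A : smooth_atlas R n M) (c : R -> M) : Prop :=
  forall t : R, 0 <= t <= 1 -> let i := chart_at A (c t) in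
    exists U : set R, [/\ open U, U t, c @` U `<=` dom i &
      smooth_on U (coord i \o c)].

Definition speed (R : realType) (n : nat) (M : topologicalType)
    (A : smooth_atlas R n M) (g : riemannian_metric A) (c : R -> M)
    (t : R) : R :=
  tangent_norm g (c t) (derive1 (coord (chart_at A (c t)) \o c) t).

Definition arc_length (R : realType) (n : nat) (M : topologicalType)
    (A : smooth_atlas R n M) (g : riemannian_metric A) (c : R -> M) : R :=
  \int[lebesgue_measure]_(t in `[0, 1]) speed g c t.

(* [joined g x y l]: some piecewise smooth curve (a finite concatenation of
   smooth arcs) from [x] to [y] has length [l]. *)
Inductive joined (R : realType) (n : nat) (M : topologicalType)
    (A : smooth_atlas R n M) (g : riemannian_metric A) : M -> M -> R -> Prop :=
| joined_arc c : smooth_arc A c -> joined g (c 0) (c 1) (arc_length g c)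
| joined_cat x y z k l :
    joined g x y k -> joined g y z l -> joined g x z (k + l).

Definition geodesic_dist (R : realType) (n : nat) (M : topologicalType)
    (A : smooth_atlas R n M) (g : riemannian_metric A) (x y : M) : \bar R :=
  ereal_inf [set l%:E | l in joined g x y].

Definition is_metric (R : realType) (X : Type) (d : X -> X -> R) : Prop :=
  [/\ forall x y, 0 <= d x y,
      forall x y, d x y = 0 <-> x = y,
      forall x y, d x y = d y x &
      forall x y z, d x z <= d x y + d y z].

Definition induces_topology (R : realType) (X : topologicalType)
    (d : X -> X -> R) : Prop :=
  forall (x : X) (U : set X),
    nbhs x U <-> exists2 e : R, 0 < e & [set y | d x y < e] `<=` U.

Definition restricts_to_geodesic_dist (R : realType) (n : nat)
    (M : topologicalType) (A : smooth_atlas R n M) (g : riemannian_metric A)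
    (d : M -> M -> R) : Prop :=
  forall x y, connected_component [set: M] x y ->
    (d x y)%:E = geodesic_dist g x y.

Definition is_group_action (G : groupType) (X : Type) (act : G -> X -> X) :
    Prop :=
  (forall x, act 1%g x = x) /\
  (forall a b x, act (a * b)%g x = act a (act b x)).

Definition isometric_action (R : realType) (G X : Type) (d : X -> X -> R)
    (act : G -> X -> X) : Prop :=
  forall a x y, d (act a x) (act a y) = d x y.

Definition wandering (G : Type) (X : topologicalType) (act : G -> X -> X) :
    Prop :=
  forall p, exists U : set X, [/\ open U, U p &
    finite_set [set a | (act a @` U) `&` U !=set0]].

Definition stabilizer (G X : Type) (act : G -> X -> X) (p : X) : set G :=
  [set a | act a p = p].

Definition isotropy (R : realType) (n : nat) (M : topologicalType)
    (A : smooth_atlas R n M) (G : Type) (act : G -> M -> M) (p : M)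
    (a : G) : 'rV[R]_n -> 'rV[R]_n :=
  differential A (act a) p.

Definition orbit_of (G X : Type) (S : set G) (act : G -> X -> X) (x : X) :
    set X := [set act a x | a in S].

Definition orbit_space (G X : Type) (S : set G) (act : G -> X -> X) : Type :=
  {O : set X | exists x, O = orbit_of S act x}.

Definition quotient_dist (R : realType) (G X : Type) (S : set G)
    (act : G -> X -> X) (d : X -> X -> R) (O P : orbit_space S act) : R :=
  inf [set d p q | p in sval O & q in sval P].

Section Distortion.
Local Open Scope ereal_scope.

(* In [\bar R], [+oo * 0 = 0], so infinite constants put no constraint on pairs
   at distance 0 and a finite nonzero distance rules out [a = +oo] below. *)
Definition lower_lipschitz (R : realType) (X Y : Type) (dX : X -> X -> R)
    (dY : Y -> Y -> R) (f : X -> Y) : \bar R :=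
  ereal_sup [set a | 0 <= a /\
    forall x x', a * (dX x x')%:E <= (dY (f x) (f x'))%:E].

Definition upper_lipschitz (R : realType) (X Y : Type) (dX : X -> X -> R)
    (dY : Y -> Y -> R) (f : X -> Y) : \bar R :=
  ereal_inf [set b | 0 <= b /\
    forall x x', (dY (f x) (f x'))%:E <= b * (dX x x')%:E].

Definition distortion (R : realType) (X Y : Type) (dX : X -> X -> R)
    (dY : Y -> Y -> R) (f : X -> Y) : \bar R :=
  let alpha := lower_lipschitz dX dY f in
  let beta := upper_lipschitz dX dY f in
  if (alpha == 0) || (beta == +oo) then +oo else beta / alpha.

Definition is_hilbert (R : realType) (H : completeNormedModType R) : Prop :=
  exists phi : {dot H for idfun}, forall x : H, phi x x = (`|x| ^+ 2)%R.

(* Only real Hilbert spaces are considered; complex ones are covered by taking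
   the real part of their inner product. The distortion of a map on a space
   with at most one point is degenerate, hence the convention for that case. *)
Definition euclidean_distortion (R : realType) (X : Type) (d : X -> X -> R) :
    \bar R :=
  if `[< forall x y : X, x = y >] then 1 else
  ereal_inf [set c | exists (H : completeNormedModType R) (f : X -> H),
    is_hilbert H /\ distortion d (fun u v : H => `|u - v|%R) f = c].

End Distortion.

(* Main.v *)
(** Near [p] the metric in a chart is within a factor [1 + C rho] of the inner
    product at [p] on the ball of radius [rho]: a segment bounds [d] from above,
    and from below the distance to a point, capped so that it extends to [M] by
    a constant, is Lipschitz along every curve. Hence an isometry [f] fixing [p]
    satisfies [<f u, f w> = <u, w> + O(rho^3)] in the chart, so the rescalings
    [2^k f(2^-k u)] converge geometrically to a linear isometry, the
    differential of [f] at [p] (Myers-Steenrod at a fixed point). As the action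
    is wandering, distances in [M/G] near [[p]] are attained on the finite group
    [G_p], and [M/G] rescaled by [k] around [[p]] converges to [T_pM/G_p].
    Rescaling a map [M/G -> H] accordingly and taking the ultraproduct of
    countably many copies of [H] gives a map on [T_pM/G_p] with no larger
    distortion. *)

From HB Require Import structures.
Require Import Defs.
From mathcomp Require Import all_boot all_order all_algebra.
From mathcomp Require Import all_classical all_reals all_analysis.
From mathcomp Require Import ring lra.
From mathcomp Require Import ring_quotient generic_quotient.
Set Implicit Arguments.
Unset Strict Implicit.
Unset Printing Implicit Defensive.
Import Order.TTheory GRing.Theory Num.Theory.
Import numFieldNormedType.Exports.
Local Open Scope classical_set_scope.
Local Open Scope ring_scope.
Local Open Scope quotient_scope.
Import Defs.

(** * Ultraproducts of Hilbert spaces *)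

(** The exponent 3 is what makes differentiability work: errors $O(\rho^3)$ in inner products give
    $|f(u/2)-f(u)/2|=O(\rho^{3/2})$, and with $\rho$ of order $2^{-k}$ the rescaling by $2^k$ leaves
    $O(2^{-k/2})$, which is summable. Only first-order control of the metric at one point enters, so
    straight segments in a chart replace geodesics and the exponential map. An ordinary limit of the
    rescaled maps is out of reach, because bounded subsets of $H$ need not be precompact, and a weak
    limit could lose the lower Lipschitz bound. In the ultraproduct the norms of differences
    converge, so both Lipschitz bounds survive. The differentials of stabilizer elements are never
    composed by the chain rule: the invariance that the tangent quotient needs is read off from
    limits of rescaled distances in $M$. *)

Definition ultra_oo : set_system nat :=
  sval (cid (ultraFilterLemma eventually_filter)).

Lemma ultra_ooP : UltraFilter ultra_oo.
Proof. by rewrite /ultra_oo; case: cid => U []. Qed.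
#[global] Existing Instance ultra_ooP.

Lemma eventually_ultra_oo : \oo `<=` ultra_oo.
Proof. by rewrite /ultra_oo; case: cid => U []. Qed.

Lemma cvg_ultra_oo (T : topologicalType) (a : nat -> T) (l : T) :
  a @ \oo --> l -> a @ ultra_oo --> l.
Proof. by move=> al A /al; exact: eventually_ultra_oo. Qed.

(** The image of an ultrafilter under [a] is again an ultrafilter, and an ultrafilter containing a
    compact set converges in it. *)
Lemma compact_cvg_ultra_oo (T : topologicalType) (K : set T) (a : nat -> T) :
  compact K -> ultra_oo (a @^-1` K) -> exists2 l, K l & a @ ultra_oo --> l.
Proof.
rewrite compact_ultra => /(_ [set A | (a @ ultra_oo) A]) Kc aK.
have [||l [Kl al]] := Kc; [|exact: aK|by exists l].
split; first exact: fmap_proper_filter.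
move=> G PG sG; rewrite eqEsubset; split=> // A GA /=.
have [//|nA] := in_ultra_setVsetC (a @^-1` A) ultra_ooP.
exfalso; apply: (@filter_not_empty _ G PG); rewrite -(setICr A).
by apply: filterI => //; exact: (sG (~` A) nA).
Qed.

Lemma bounded_cvg_ultra_oo (R : realType) (a : nat -> R) (C : R) :
  (forall k, `|a k| <= C) -> a @ ultra_oo --> lim (a @ ultra_oo).
Proof.
move=> aC; have [|l _ al] := compact_cvg_ultra_oo (a := a) (@segment_compact R (- C) C).
  by apply: filterE => k /=; rewrite in_itv /= -ler_norml.
by apply/cvg_ex; exists l.
Qed.

Section Ultraproduct.
Context {R : realType} {H : completeNormedModType R}.

Definition bounded_seq : {pred nat -> H} :=
  [pred u | `[< exists C, forall k, `|u k| <= C >]].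

Lemma bounded_seq_submod : GRing.submod_closed bounded_seq.
Proof.
split; first by apply/asboolP; exists 0 => k; rewrite normr0.
move=> a u v /asboolP[C uC] /asboolP[D vD]; apply/asboolP.
exists (`|a| * C + D) => k; apply: (le_trans (ler_normD _ _)).
by rewrite normrZ lerD // ler_wpM2l.
Qed.

HB.instance Definition _ :=
  GRing.isSubmodClosed.Build R (nat -> H) bounded_seq
    bounded_seq_submod.

Record bseq := BSeq { bval :> nat -> H; bvalP : bval \in bounded_seq }.
HB.instance Definition _ := [isSub for bval].
HB.instance Definition _ := [Choice of bseq by <:].
HB.instance Definition _ := [SubChoice_isSubLmodule of bseq by <:].

Lemma bseq_bounded (u : bseq) : exists C, forall k, `|u k| <= C.
Proof. by case: u => u /= /asboolP. Qed.

Definition unorm (u : bseq) : R := lim ((fun k => `|u k|) @ ultra_oo).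

Lemma cvg_unorm (u : bseq) : (fun k => `|u k|) @ ultra_oo --> unorm u.
Proof.
have [C uC] := bseq_bounded u.
by apply: (@bounded_cvg_ultra_oo _ _ C) => k; rewrite normr_id.
Qed.

Lemma unorm_le (u : bseq) (A : set nat) c :
  ultra_oo A -> (forall k, A k -> `|u k| <= c) -> unorm u <= c.
Proof.
move=> UA uc; apply: (cvgr_to_le (@cvg_unorm u)).
exact: filterS UA.
Qed.

Lemma unorm_ge (u : bseq) (A : set nat) c :
  ultra_oo A -> (forall k, A k -> c <= `|u k|) -> c <= unorm u.
Proof.
move=> UA uc; apply: (cvgr_to_ge (@cvg_unorm u)).
exact: filterS UA.
Qed.

Lemma unorm_ge0 u : 0 <= unorm u.
Proof. by apply: (@unorm_ge _ setT); first exact: filterT. Qed.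

Lemma unormD u v : unorm (u + v) <= unorm u + unorm v.
Proof.
apply: (ler_cvg_to (@cvg_unorm (u + v)) (cvgD (@cvg_unorm u) (@cvg_unorm v))).
by apply: nearW => k /=; exact: ler_normD.
Qed.

Lemma unormZ a u : unorm (a *: u) = `|a| * unorm u.
Proof.
have := @cvg_unorm (a *: u) => /(cvg_unique (@norm_hausdorff _ _)); apply.
rewrite (_ : (fun k => _) = (fun k => `|a| * `|u k|)).
  exact: cvgMl_tmp (@cvg_unorm u).
by apply/funext => k; rewrite -normrZ.
Qed.

Definition null_seq : {pred bseq} := [pred u | unorm u == 0].

Lemma null_seq_zmod : zmod_closed null_seq.
Proof.
split; first by rewrite inE -(scale0r 0) unormZ normr0 mul0r.
move=> u v; rewrite !inE => /eqP u0 /eqP v0.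
rewrite eq_le unorm_ge0 andbT (le_trans (unormD _ _)) // u0 add0r.
by rewrite -scaleN1r unormZ v0 mulr0.
Qed.

HB.instance Definition _ := GRing.isZmodClosed.Build bseq null_seq null_seq_zmod.

Definition ultraprod := Quotient.quot null_seq.
HB.instance Definition _ := Choice.on ultraprod.
HB.instance Definition _ := GRing.Zmodule.on ultraprod.
HB.instance Definition _ := EqQuotient.on ultraprod.

Definition upi (u : bseq) : ultraprod := \pi_ultraprod u.

Lemma upi_eq u v : upi u = upi v <-> unorm (u - v) = 0.
Proof.
rewrite /upi; split.
  by move=> /eqP; rewrite -Quotient.idealrBE => /eqP.
by move=> uv; apply/eqP; rewrite -Quotient.idealrBE; apply/eqP.
Qed.

Lemma upiD u v : upi (u + v) = upi u + upi v.
Proof. by rewrite /upi !piE. Qed.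

Lemma upiB u v : upi (u - v) = upi u - upi v.
Proof. by rewrite /upi !piE. Qed.

Lemma urepr (x : ultraprod) : upi (repr x) = x.
Proof. exact: reprK. Qed.

Lemma upi_ind (P : ultraprod -> Prop) : (forall u, P (upi u)) -> forall x, P x.
Proof. by move=> Pu x; rewrite -[x]urepr. Qed.

(** The quotient by a subgroup carries only the additive structure, so scaling goes through
    representatives; [upiZ] shows that the choice does not matter. *)
Definition uscale (a : R) (x : ultraprod) : ultraprod := upi (a *: repr x).

Lemma upiZ a u : upi (a *: u) = uscale a (upi u).
Proof.
apply/upi_eq; rewrite -scalerBr unormZ.
have /upi_eq -> : upi u = upi (repr (upi u)) by rewrite urepr.
by rewrite mulr0.
Qed.

Lemma uscaleA a b x : uscale a (uscale b x) = uscale (a * b) x.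
Proof. by elim/upi_ind: x => u; rewrite -!upiZ scalerA. Qed.

Lemma uscale1 : left_id 1 uscale.
Proof. by elim/upi_ind => u; rewrite -!upiZ scale1r. Qed.

Lemma uscaleDr : right_distributive uscale +%R.
Proof.
move=> a; elim/upi_ind => u; elim/upi_ind => v.
by rewrite -[upi u + _]upiD -!upiZ -upiD scalerDr.
Qed.

Lemma uscaleDl x : {morph uscale^~ x : a b / a + b}.
Proof. by elim/upi_ind: x => u a b; rewrite /= -!upiZ -upiD scalerDl. Qed.

HB.instance Definition _ :=
  GRing.Zmodule_isLmodule.Build R ultraprod uscaleA uscale1 uscaleDr uscaleDl.

Definition qnorm (x : ultraprod) : R := unorm (repr x).

Lemma unorm_eq u v : unorm (u - v) = 0 -> unorm u = unorm v.
Proof.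
move=> uv0; apply/eqP; rewrite eq_le; apply/andP; split.
  by rewrite -{1}(subrK v u) (le_trans (unormD _ _)) // uv0 add0r.
rewrite -{1}(subrK u v) (le_trans (unormD _ _)) //.
by rewrite -opprB -scaleN1r unormZ uv0 mulr0 add0r.
Qed.

Lemma qnorm_pi u : qnorm (upi u) = unorm u.
Proof. by apply/unorm_eq/upi_eq; rewrite urepr. Qed.

Lemma qnormD x y : qnorm (x + y) <= qnorm x + qnorm y.
Proof.
elim/upi_ind: x => u; elim/upi_ind: y => v.
by rewrite -upiD !qnorm_pi unormD.
Qed.

Lemma qnormZ a (x : ultraprod) : qnorm (a *: x) = `|a| * qnorm x.
Proof.
elim/upi_ind: x => u; rewrite -[a *: _]/(uscale a _) -upiZ.
by rewrite !qnorm_pi unormZ.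
Qed.

Lemma qnorm_eq0 (x : ultraprod) : qnorm x = 0 -> x = 0.
Proof.
elim/upi_ind: x => u; rewrite qnorm_pi => u0.
by rewrite -[0](subrr (upi 0)) -upiB subr0; apply/upi_eq; rewrite subr0.
Qed.

HB.instance Definition _ :=
  Lmodule_isNormed.Build R ultraprod qnormD qnormZ qnorm_eq0.

Lemma norm_upi u : `|upi u| = unorm u.
Proof. exact: qnorm_pi. Qed.

(** The right-hand side is the exact sum of $2^{-j}$ over $m\le j<m+d$; keeping the negative term is
    what lets the induction close. *)
Lemma telescope_half (a : nat -> H) m d :
  (forall j, (j < m + d)%N -> `|a j.+1 - a j| <= 2^-1 ^+ j) ->
  `|a (m + d)%N - a m| <= 2 * 2^-1 ^+ m - 2 * 2^-1 ^+ (m + d).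
Proof.
elim: d => [|d IH] ad; first by rewrite addn0 !subrr normr0.
move: ad; rewrite addnS => ad.
rewrite -(subrKA (a (m + d)%N)) (le_trans (ler_normD _ _)) //.
have := IH (fun j jd => ad j (ltn_trans jd (ltnSn _))).
have := ad (m + d)%N (ltnSn _).
by rewrite exprS; set x := `|_|; set y := `|_|; lra.
Qed.

(* At index [k] the limit takes the value of the last [u m], [m <= k], up to
   which all consecutive differences are small at [k]. *)
Lemma diagonal_seq (u : nat -> bseq) :
  (forall m, unorm (u m.+1 - u m) < 2^-1 ^+ m) ->
  exists w, forall m, unorm (w - u m) <= 2 * 2^-1 ^+ m.
Proof.
move=> u_cauchy.
pose G j : set nat := [set k | `|u j.+1 k - u j k| <= 2^-1 ^+ j].
have UG j : ultra_oo (G j).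
  have h := @cvg_unorm (u j.+1 - u j).
  have h2 := cvgr_lt _ h _ (u_cauchy j).
  by apply: filterS (h2 _) => k /= /ltW.
(* The clause [m <= k] makes the maximum exist; each fixed [m] satisfies it for all large [k]. *)
pose P k m := (m <= k)%N && `[< forall j, (j < m)%N -> G j k >].
have P0 k : exists m, P k m by exists 0%N; apply/andP; split => //; apply/asboolP.
have Pb k m : P k m -> (m <= k)%N by move=> /andP[].
pose mx k := ex_maxn (P0 k) (Pb k).
have mxP k : P k (mx k) by rewrite /mx; case: ex_maxnP.
have mx_max k m : P k m -> (m <= mx k)%N by rewrite /mx; case: ex_maxnP => i _; apply.
have est k m : P k m -> `|u (mx k) k - u m k| <= 2 * 2^-1 ^+ m.
  move=> /mx_max mk; have := @telescope_half (fun j => u j k) m (mx k - m)%N.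
  rewrite subnKC // => h; apply: le_trans (h _) _.
    by have /andP[_ /asboolP] := mxP k.
  by rewrite lerBlDr lerDl mulr_ge0 // exprn_ge0 // invr_ge0.
have [C uC] := bseq_bounded (u 0%N).
have wP : (fun k => u (mx k) k) \in bounded_seq.
  apply/asboolP; exists (2 + C) => k.
  rewrite -(subrK (u 0%N k) (u _ k)) (le_trans (ler_normD _ _)) // lerD //.
  by have := est k 0%N; rewrite expr0 mulr1; apply; apply/andP; split => //; apply/asboolP.
exists (BSeq wP) => m.
pose A : set nat := [set k | P k m].
apply: (@unorm_le _ A) => [|k]; last exact: est.
rewrite (_ : A = [set k | (m <= k)%N] `&` [set k | forall j, (j < m)%N -> G j k]).
  apply: filterI; first by apply: eventually_ultra_oo; exact: nbhs_infty_ge.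
  elim: {A} m => [|m IH]; first exact: filterE.
  apply: filterS2 IH (UG m) => k Gk Gm j.
  by rewrite ltnS leq_eqVlt => /predU1P[->//|/Gk].
apply/seteqP; split => k; first by move=> /andP[? /asboolP].
by move=> [? ?]; apply/andP; split => //; apply/asboolP.
Qed.

(** Any two members of [F] meet, so the centres of balls of radius $2^{-(m+1)}$ lying in [F] have
    consecutive distances below $2^{-m}$, as [diagonal_seq] requires. *)
Lemma ultraprod_complete (F : set_system ultraprod) :
  ProperFilter F -> cauchy F -> cvg F.
Proof.
move=> FF /cauchyP F_cauchy.
have half_gt0 m : 0 < 2^-1 ^+ m.+1 :> R by rewrite exprn_gt0 // invr_gt0.
pose x m : ultraprod := sval (cid (F_cauchy _ (half_gt0 m))).
have xP m : F (ball (x m) (2^-1 ^+ m.+1)) by rewrite /x; case: cid.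
have [m|w wP] := @diagonal_seq (fun m => repr (x m)).
  rewrite -norm_upi upiB !urepr.
  have [y []] := filter_ex (filterI (xP m.+1) (xP m)).
  rewrite -ball_normE /= => xy1 xy2.
  rewrite -(subrKA y) (le_lt_trans (ler_normD _ _)) //
    [ltRHS](_ : _ = 2^-1 ^+ m.+1 + 2^-1 ^+ m.+1).
    rewrite ltr_leD //; last by rewrite distrC ltW.
    by apply: (lt_trans xy1); rewrite exprS gtr_pMl //; lra.
  by rewrite exprS; field.
apply/cvg_ex; exists (upi w); apply/cvgrPdist_le => e e0.
(* The 3 is the 2 of [diagonal_seq] plus 1 for the distance from [x m] to a point of its ball. *)
have : (fun m => 3 * 2^-1 ^+ m : R) @ \oo --> (0 : R).
  rewrite -[0](mulr0 3); apply: cvgMl_tmp; apply: cvg_expr.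
  by rewrite ger0_norm; lra.
move=> /cvgr0Pnorm_le /(_ e e0) [m _ /(_ m (leqnn _))].
rewrite ger0_norm; last by rewrite mulr_ge0 // exprn_ge0 // invr_ge0.
move=> me; near=> y.
rewrite -(subrKA (x m)) (le_trans (ler_normD _ _)) // (le_trans _ me) //.
rewrite [leRHS](_ : _ = 2 * 2^-1 ^+ m + 2^-1 ^+ m); last by ring.
rewrite lerD //; first by rewrite -[x m]urepr -upiB norm_upi.
have : ball (x m) (2^-1 ^+ m.+1) y by near: y.
rewrite -ball_normE /= => /ltW /le_trans; apply.
by rewrite exprS ger_pMl ?exprn_gt0 //; lra.
Unshelve. all: by end_near. Qed.

HB.instance Definition _ := Uniform_isComplete.Build ultraprod ultraprod_complete.

Section Dot.
Variable phi : {dot H for idfun}.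
Hypothesis phiE : forall x, phi x x = `|x| ^+ 2.

(** Polarization is used because the norm already descends to the quotient. [cvg_udot] identifies
    the value with the limit of [phi] along representatives, and bilinearity is inherited from
    there. *)
Definition udot (x y : ultraprod) : R :=
  2^-1 * (`|x + y| ^+ 2 - `|x| ^+ 2 - `|y| ^+ 2).

Lemma dot_sym x y : phi x y = phi y x.
Proof. by rewrite hermitian_subproof expr0 mul1r. Qed.

Lemma dot_polar x y : phi x y = 2^-1 * (`|x + y| ^+ 2 - `|x| ^+ 2 - `|y| ^+ 2).
Proof.
have -> : `|x + y| ^+ 2 = phi x x + phi x y + (phi y x + phi y y).
  by rewrite -phiE linearDl !linearDr.
by rewrite -!phiE (dot_sym y x); field.
Qed.

Lemma cvg_udot (u v : bseq) :
  (fun k => phi (u k) (v k)) @ ultra_oo --> udot (upi u) (upi v).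
Proof.
rewrite (_ : (fun k => _) =
  fun k => 2^-1 * (`|(u + v) k| ^+ 2 - `|u k| ^+ 2 - `|v k| ^+ 2)).
  rewrite /udot -upiD !norm_upi; apply: cvgMl_tmp.
  apply: cvgB; first apply: cvgB; rewrite expr2;
  by under eq_fun do rewrite expr2; apply: cvgM; exact: cvg_unorm.
by apply/funext => k; rewrite dot_polar.
Qed.

Lemma udotDZ a (x y z : ultraprod) : udot (a *: x + y) z = a * udot x z + udot y z.
Proof.
elim/upi_ind: x => u; elim/upi_ind: y => v; elim/upi_ind: z => w.
rewrite -[a *: _]/(uscale a _) -upiZ -upiD.
apply: (cvg_unique (@norm_hausdorff _ _) (@cvg_udot _ _)).
rewrite (_ : (fun k => _) = fun k => a * phi (u k) (w k) + phi (v k) (w k)).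
  by apply: cvgD; [apply: cvgMl_tmp|]; exact: cvg_udot.
by apply/funext => k; rewrite linearPl.
Qed.

Lemma udotC x y : udot x y = udot y x.
Proof. by rewrite /udot (addrC x y) addrAC. Qed.

Lemma udotE x : udot x x = `|x| ^+ 2.
Proof.
by rewrite /udot -mulr2n -[x *+ 2]scaler_nat normrZ normr_nat; set a := `|x|; field.
Qed.

End Dot.

Lemma ultraprod_hilbert : is_hilbert H -> is_hilbert ultraprod.
Proof.
move=> [phi phiE].
have bil : bilinear_for ( *%R) (idfun \; *%R) udot.
  split => [z a x y|z a x y]; first by rewrite (udotDZ phiE).
  by rewrite !(udotC z) (udotDZ phiE).
have pos (x : ultraprod) : x != 0 -> 0 < udot x x.
  by move=> x0; rewrite udotE exprn_gt0 // normr_gt0.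
pose f : {dot ultraprod for idfun} := HB.pack udot
  (bilinear_isBilinear.Build R _ _ _ _ _ udot bil)
  (isHermitianSesquilinear.Build R _ false idfun udot (fun x y => etrans (udotC x y) (esym (mul1r _))))
  (isDotProduct.Build R _ udot pos).
by exists f => x; rewrite /= udotE.
Qed.

End Ultraproduct.

(** * Differentials and functions of class C^k *)

Section Differentials.
Context {R : realType} {V W : normedModType R}.

Lemma diff_approx (f : V -> W) x : differentiable f x ->
  forall e, 0 < e -> \forall h \near 0, `|f (h + x) - f x - 'd f x h| <= e * `|h|.
Proof.
move=> df e e0; have /eqaddoP /(_ e e0) := diff_locally df.
by apply: filterS => h /=; rewrite !fctE opprD addrA.
Qed.

Lemma diff_approx_near (f : V -> W) x : differentiable f x ->
  forall e, 0 < e -> \forall y \near x, `|f y - f x - 'd f x (y - x)| <= e * `|y - x|.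
Proof.
move=> df e e0; have sh : (fun y : V => y - x) @ x --> (0 : V).
  by rewrite -[X in _ --> X](subrr x); apply: cvgB; [exact: cvg_id | exact: cvg_cst].
have h : \forall y \near x, `|f (y - x + x) - f x - 'd f x (y - x)| <= e * `|y - x|.
  exact: sh _ (diff_approx df e0).
by near=> y; rewrite -{1}(subrK x y); near: y.
Unshelve. all: by end_near.
Qed.

Lemma diff_approx_unique (f : V -> W) (L : {linear V -> W}) x :
  continuous L ->
  (forall e, 0 < e -> \forall h \near 0, `|f (h + x) - f x - L h| <= e * `|h|) ->
  differentiable f x /\ 'd f x = L :> (V -> W).
Proof.
move=> Lc fL.
have eq : f \o shift x = cst (f x) + L +o_0 id.
  apply/eqaddoP => e e0; apply: filterS (fL e e0) => h /=.
  by rewrite !fctE opprD addrA.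
have dL := diff_unique Lc eq; split => //.
by apply/diff_locallyP; rewrite dL.
Qed.

Lemma near_eq_differentiable (f g : V -> W) x :
  (\forall y \near x, f y = g y) -> differentiable f x ->
  differentiable g x /\ 'd g x = 'd f x :> (V -> W).
Proof.
move=> fg df; apply: diff_approx_unique; first exact: diff_continuous.
move=> e e0; have fgx := nbhs_singleton fg.
have sh : (fun h : V => h + x) @ (0 : V) --> x.
  by rewrite -[X in _ --> X]add0r; apply: cvgD; [exact: cvg_id | exact: cvg_cst].
have fg0 : \forall h \near (0 : V), f (h + x) = g (h + x) := sh _ fg.
near=> h; rewrite -fgx -(near fg0 h) //; near: h; exact: diff_approx.
Unshelve. all: by end_near. Qed.

(** On an open set, equality of values persists near each point and therefore passes to all
    directional derivatives. *)
Lemma Ck_ext (k : nat) (A : set V) (f g : V -> W) :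
  open A -> (forall x, A x -> f x = g x) -> Ck k A f -> Ck k A g.
Proof.
move=> Ao; elim: k f g => [|k IH] f g fg /=.
  move=> fc x Ax; have nfg : \forall y \near x, f y = g y.
    by apply: filterS (open_nbhs_nbhs (conj Ao Ax)) => y; exact: fg.
  apply: cvg_trans; last by rewrite -(fg x Ax); exact: fc x Ax.
  exact: near_eq_cvg.
move=> [df Ckf].
have nfg x : A x -> \forall y \near x, f y = g y.
  by move=> Ax; apply: filterS (open_nbhs_nbhs (conj Ao Ax)) => y; exact: fg.
split=> [x Ax|v].
  by have [] := near_eq_differentiable (nfg x Ax) (df x Ax).
apply: IH (Ckf v) => x Ax; exact: near_eq_derive (nfg x Ax).
Qed.

End Differentials.

Section Line.
Context {R : realType} {V : normedModType R}.

Lemma line_continuous (a v : V) (t : R) : {for t, continuous (fun t : R => a + t *: v)}.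
Proof. by apply: cvgD; [exact: cvg_cst | apply: cvgZr_tmp; exact: cvg_id]. Qed.

Lemma line_is_diff (a v : V) (t : R) :
  is_diff t (fun t : R => a + t *: v) (fun t : R => t *: v).
Proof.
have h := @is_diffD R _ _ (cst a) (fun t : R => t *: v) _ _ t
  (is_diff_cst a t) (is_diff_scalel t v).
by apply: is_diff_eq h _; rewrite add0r.
Qed.

End Line.

(** By the chain rule, the derivative along the scalar [w] is ['D_(w *: v) f] restricted to the
    line, again a function of the same kind; hence an induction with [f] general. *)
Lemma Ck_line (R : realType) (V W : normedModType R) (k : nat) (A : set V)
    (f : V -> W) (a v : V) :
  open A -> Ck k A f ->
  Ck k [set t : R | A (a + t *: v)] (fun t : R => f (a + t *: v)).
Proof.
move=> Ao.
have lo : open [set t : R | A (a + t *: v)].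
  by apply: (open_comp (f := fun t : R => a + t *: v)) => // t _; exact: line_continuous.
have ld := @line_is_diff _ _ a v.
elim: k f => [|k IH] f /=.
  move=> fc t At; apply: (@continuous_comp _ _ _ (fun t : R => a + t *: v) f).
    exact: line_continuous.
  exact: fc.
move=> [df Ckf]; split=> [t At|w].
  apply: (@differentiable_comp _ _ _ _ (fun t : R => a + t *: v)) => //.
  exact: df.
apply: (@Ck_ext _ _ _ _ _ (fun t : R => 'D_(w *: v) f (a + t *: v))) => //.
  move=> t At; rewrite !deriveE //; last 2 first.
  - apply: (@differentiable_comp _ _ _ _ (fun t : R => a + t *: v)) => //.
    exact: df.
  - exact: df.
  rewrite (@diff_comp _ _ _ _ (fun t : R => a + t *: v) f) //=; last exact: df.
  by rewrite (@diff_val _ _ _ _ _ _ _ (ld t)).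
exact: (IH ('D_(w *: v) f) (Ckf _)).
Qed.

(** * Inner products on row vectors *)

(** [tangent_norm] is the case of the Gram matrix at [p]. With the matrix as an argument, the
    metrics at different points of a chart can be compared on one vector. *)
Definition nrm (R : realType) (n : nat) (S : 'M[R]_n) (v : 'rV[R]_n) : R :=
  Num.sqrt (bilin S v v).

Section Bilin.
Context {R : realType} {n : nat}.
Implicit Types (S : 'M[R]_n) (u v w : 'rV[R]_n).

Lemma bilinDl S u v w : bilin S (u + v) w = bilin S u w + bilin S v w.
Proof. by rewrite /bilin !mulmxDl mxE. Qed.

Lemma bilinDr S u v w : bilin S w (u + v) = bilin S w u + bilin S w v.
Proof. by rewrite /bilin linearD mulmxDr mxE. Qed.

Lemma bilinZl S a u w : bilin S (a *: u) w = a * bilin S u w.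
Proof. by rewrite /bilin -!scalemxAl mxE. Qed.

Lemma bilinZr S a u w : bilin S w (a *: u) = a * bilin S w u.
Proof. by rewrite /bilin linearZ -scalemxAr mxE. Qed.

Lemma bilin0l S w : bilin S 0 w = 0.
Proof. by rewrite /bilin !mul0mx mxE. Qed.

Lemma bilin0r S w : bilin S w 0 = 0.
Proof. by rewrite /bilin trmx0 mulmx0 mxE. Qed.

Lemma bilinNl S u w : bilin S (- u) w = - bilin S u w.
Proof. by rewrite -scaleN1r bilinZl mulN1r. Qed.

Lemma bilinNr S u w : bilin S w (- u) = - bilin S w u.
Proof. by rewrite -scaleN1r bilinZr mulN1r. Qed.

Lemma bilin_subM S T u w : bilin (S - T) u w = bilin S u w - bilin T u w.
Proof. by rewrite /bilin mulmxBr mulmxBl !mxE. Qed.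

Lemma bilinC S u w : S^T = S -> bilin S u w = bilin S w u.
Proof.
move=> St; have tr11 (T : 'M[R]_1) : T ord0 ord0 = T^T ord0 ord0 by rewrite mxE.
by rewrite /bilin tr11 !trmx_mul trmxK St mulmxA.
Qed.

(** The ambient norm is the largest absolute value of an entry, and the double sum has $n^2$
    terms. *)
Lemma bilin_le S u w : `|bilin S u w| <= n%:R ^+ 2 * `|S| * `|u| * `|w|.
Proof.
have ent p q (T : 'M[R]_(p, q)) i j : `|T i j| <= `|T|.
  rewrite [leRHS]/Num.norm /= mx_normrE.
  exact: (le_bigmax _ (fun ij => `|T ij.1 ij.2|) (i, j)).
rewrite /bilin mxE (le_trans (ler_norm_sum _ _ _)) //.
have -> : n%:R ^+ 2 * `|S| * `|u| * `|w| =
    \sum_(j < n) \sum_(i < n) `|u| * `|S| * `|w|.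
  have sumc (c : R) : \sum_(j < n) c = n%:R * c.
    by rewrite sumr_const card_ord mulr_natl.
  by rewrite !sumc; ring.
apply: ler_sum => j _; rewrite !mxE normrM.
rewrite -mulr_suml; apply: ler_pM => //.
rewrite (le_trans (ler_norm_sum _ _ _)) //; apply: ler_sum => i _.
by rewrite normrM ler_pM ?ent.
Qed.

Lemma nrm_ge0 S v : 0 <= nrm S v.
Proof. exact: sqrtr_ge0. Qed.

Lemma nrmZ S a v : nrm S (a *: v) = `|a| * nrm S v.
Proof. by rewrite /nrm bilinZl bilinZr mulrA -expr2 sqrtrM ?sqr_ge0 // sqrtr_sqr. Qed.

Lemma nrmN S v : nrm S (- v) = nrm S v.
Proof. by rewrite -scaleN1r nrmZ normrN1 mul1r. Qed.

Lemma nrmC S u v : nrm S (u - v) = nrm S (v - u).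
Proof. by rewrite -nrmN opprB. Qed.

Lemma nrm0 S : nrm S 0 = 0.
Proof. by rewrite /nrm bilin0l sqrtr0. Qed.

Section PosDef.
Variable S : 'M[R]_n.
Hypotheses (S_sym : S^T = S) (S_pos : forall v, v != 0 -> 0 < bilin S v v).

Lemma bilin_ge0 v : 0 <= bilin S v v.
Proof.
have [->|v0] := eqVneq v 0; last exact/ltW/S_pos.
by rewrite bilin0l.
Qed.

Lemma sqr_nrm v : nrm S v ^+ 2 = bilin S v v.
Proof. by rewrite sqr_sqrtr // bilin_ge0. Qed.

Lemma nrm_eq0 v : nrm S v = 0 -> v = 0.
Proof.
move=> v0; have [//|/S_pos] := eqVneq v 0.
by rewrite -sqr_nrm v0 expr0n ltxx.
Qed.

Lemma sqr_nrmD u v :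
  nrm S (u + v) ^+ 2 = nrm S u ^+ 2 + 2 * bilin S u v + nrm S v ^+ 2.
Proof. by rewrite !sqr_nrm bilinDl !bilinDr (bilinC v u S_sym); ring. Qed.

Lemma sqr_nrmB u v :
  nrm S (u - v) ^+ 2 = nrm S u ^+ 2 - 2 * bilin S u v + nrm S v ^+ 2.
Proof. by rewrite sqr_nrmD nrmN bilinNr; ring. Qed.

Lemma bilin_nrm_le u v : bilin S u v <= nrm S u * nrm S v.
Proof.
have [->|u0] := eqVneq u 0; first by rewrite bilin0l nrm0 mul0r.
have [->|v0] := eqVneq v 0; first by rewrite bilin0r nrm0 mulr0.
have pos w : w != 0 -> 0 < nrm S w.
  by move=> w0; rewrite lt_neqAle nrm_ge0 andbT eq_sym; apply: contra w0 => /eqP/nrm_eq0/eqP.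
(* With [a], [b], [c] as set below, this square expands to $2ab(ab-c)$. *)
have := sqr_ge0 (nrm S (nrm S v *: u - nrm S u *: v)).
rewrite sqr_nrmB !nrmZ bilinZl bilinZr !ger0_norm ?nrm_ge0 //.
have := pos u u0; have := pos v v0.
set a := nrm S u; set b := nrm S v; set c := bilin S u v => b0 a0 h.
have ab : 0 < a * b by rewrite mulr_gt0.
rewrite -subr_ge0 -(pmulr_rge0 _ ab); nra.
Qed.

Lemma nrmD u v : nrm S (u + v) <= nrm S u + nrm S v.
Proof.
rewrite -ler_sqr ?nnegrE ?addr_ge0 ?nrm_ge0 // sqr_nrmD.
have := bilin_nrm_le u v; nra.
Qed.

Lemma nrm_tri u v w : nrm S (u - w) <= nrm S (u - v) + nrm S (v - w).
Proof. by rewrite -(subrKA v) nrmD. Qed.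

Lemma nrmB_ge u v : `|nrm S u - nrm S v| <= nrm S (u - v).
Proof.
have := nrmD (u - v) v; have := nrmD (v - u) u; rewrite !subrK (nrmC S v u).
by rewrite ler_norml; lra.
Qed.

Lemma nrm_le_norm : exists2 K, 0 < K & forall v, nrm S v <= K * `|v|.
Proof.
exists (1 + n%:R * Num.sqrt `|S|); first by apply: ltr_pwDl => //; rewrite mulr_ge0 ?sqrtr_ge0.
move=> v; rewrite -ler_sqr ?nnegrE ?nrm_ge0 //.
rewrite sqr_nrm (le_trans (ler_norm _)) // (le_trans (bilin_le _ _ _)) //.
have := sqr_sqrtr (normr_ge0 S); set s := Num.sqrt _ => <-.
have h : 0 <= n%:R * s by rewrite mulr_ge0 ?sqrtr_ge0.
rewrite -subr_ge0 [X in 0 <= X](_ : _ = `|v| ^+ 2 * (1 + 2 * (n%:R * s))).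
  by rewrite mulr_ge0 ?sqr_ge0 // addr_ge0 // mulr_ge0.
by ring.
Qed.

Lemma nrm_continuous : continuous (nrm S).
Proof.
have [K K0 SK] := nrm_le_norm.
move=> v; suff : nrm S w @[w --> v] --> nrm S v by [].
apply/(@cvgrPdist_le R R _ (nbhs v)) => e e0; near=> w; rewrite (le_trans (nrmB_ge _ _)) // (le_trans (SK _)) //.
rewrite -ler_pdivlMl //.
have : ball v (K^-1 * e) w by near: w; apply: nbhsx_ballx; rewrite mulr_gt0 ?invr_gt0.
by rewrite -ball_normE /= => /ltW.
Unshelve. all: by end_near. Qed.

(** Equivalence of norms in finite dimension: the constant is the inverse of the minimum of [nrm S]
    on the compact unit sphere. *)
Lemma norm_le_nrm : exists2 c, 0 < c & forall v, `|v| <= c * nrm S v.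
Proof.
pose A : set 'rV[R]_n := [set v | `|v| = 1].
have [[v0 Av0]|A0] := pselect (exists v, A v); last first.
  (* An empty unit sphere means dimension zero, where every vector is 0. *)
  exists 1 => // v; have [->|v0] := eqVneq v 0; first by rewrite normr0 mul1r nrm_ge0.
  exfalso; apply: A0; exists (`|v|^-1 *: v); rewrite /A /= normrZ normfV normr_id.
  by rewrite mulVf // normr_eq0.
have Ac : compact A.
  apply: bounded_closed_compact.
    by exists 1; split=> // x x1 v /= ->; exact: ltW.
  rewrite (_ : A = Num.norm @^-1` [set 1]) //; apply: closed_comp => [v _|].
    exact: norm_continuous.
  exact: closed_eq.
have [] := @EVT_min_rV R n (nrm S) A (ex_intro _ v0 Av0) Ac.
  by apply: continuous_subspaceT; exact: nrm_continuous.
move=> c /set_mem Acc cmin.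
have c_gt0 : 0 < nrm S c.
  rewrite lt_neqAle nrm_ge0 andbT eq_sym; apply/eqP => /nrm_eq0 c0.
  by move: Acc; rewrite /A /= c0 normr0 => /eqP; rewrite eq_sym oner_eq0.
exists (nrm S c)^-1; first by rewrite invr_gt0.
move=> v; have [->|v_neq0] := eqVneq v 0.
  by rewrite normr0 mulr_ge0 ?invr_ge0 ?nrm_ge0.
rewrite ler_pdivlMl // -ler_pdivlMr ?normr_gt0 //.
have Av : A (`|v|^-1 *: v).
  by rewrite /A /= normrZ normfV normr_id mulVf // normr_eq0.
have := cmin _ (mem_set Av); rewrite nrmZ normfV normr_id mulrC.
exact.
Qed.

End PosDef.
End Bilin.

(** * Curves and lengths *)

Section LocalMonotony.
Context {R : realType}.

(** The product form of the hypothesis covers both sides of [t]. Its left half shows that the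
    supremum of the set of [t] with [f a <= f t] belongs to that set; its right half excludes a
    supremum below [b]. *)
Lemma locally_ndecr (f : R -> R) (a b : R) : a <= b ->
  (forall t, a <= t <= b -> \forall u \near t, 0 <= (f u - f t) * (u - t)) ->
  f a <= f b.
Proof.
move=> ab fl.
pose E : set R := [set t | a <= t <= b /\ f a <= f t].
have Ea : E a by split => //; rewrite lexx ab.
have bE : has_sup E.
  by split; [exists a | exists b => t [/andP[]]].
have tau_ab : a <= sup E <= b.
  rewrite ub_le_sup //; first by apply: ge_sup; [exists a | move=> t [/andP[]]].
  by case: bE.
have [e /= e0 fe] : exists2 e, 0 < e & forall u, `|sup E - u| < e -> 0 <= (f u - f (sup E)) * (u - sup E).
  by have /nbhs_ballP[e e0 fe] := fl _ tau_ab; exists e => // u ue; exact: fe.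
have Etau : E (sup E).
  split => //; have [t Et te] := sup_adherent e0 bE.
  have tE : t <= sup E by apply: ub_le_sup => //; case: bE.
  case: Et => _ /le_trans; apply.
  move: tE; rewrite le_eqVlt => /predU1P[->//|tE].
  have := fe t; rewrite gtr0_norm ?subr_gt0 // ltrBlDr -ltrBlDl => /(_ te).
  by rewrite nmulr_lge0 ?subr_lt0 // subr_le0.
have [tb|tb] := ltP (sup E) b; last first.
  by case: Etau => /andP[_ tb'] ; have /eqP -> : b == sup E by rewrite eq_le tb tb'.
pose u := Num.min (sup E + e / 2) b.
have ut : sup E < u by rewrite lt_min tb andbT ltrDl divr_gt0.
have ue : u - sup E < e.
  by rewrite ltrBlDl gt_min ltrD2l ltr_pdivrMr // ltr_pMr // ltr1n.
have Eu : E u.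
  split; first by rewrite ge_min lexx orbT andbT (le_trans _ (ltW ut)) //; case/andP: tau_ab.
  case: Etau => _ /le_trans; apply.
  have := fe u; rewrite distrC gtr0_norm ?subr_gt0 // => /(_ ue).
  by rewrite pmulr_lge0 ?subr_gt0 // subr_ge0.
by have := ub_le_sup (proj2 bE) Eu; rewrite leNgt ut.
Qed.

Let mu := @lebesgue_measure R.

Lemma continuous_integrable (s : R -> R) a b :
  continuous s -> mu.-integrable `[a, b] (EFin \o s).
Proof.
move=> sc; apply: continuous_compact_integrable; first exact: segment_compact.
exact: continuous_subspaceT.
Qed.

(** Speeds are controlled only on [[0, 1]]; composing with the retraction of the line onto that
    interval gives a globally continuous integrand. *)
Lemma clamp_continuous (s : R -> R) :
  (forall t, 0 <= t <= 1 -> {for t, continuous s}) ->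
  exists2 s' : R -> R, continuous s' & forall t, 0 <= t <= 1 -> s' t = s t.
Proof.
move=> sc; pose cl (t : R) := Num.max 0 (Num.min t 1).
have cl01 t : 0 <= cl t <= 1.
  by rewrite le_max lexx /= ge_max ler01 ge_min lexx orbT.
exists (s \o cl); last first.
  by move=> t /andP[t0 t1]; rewrite /= /cl min_l // max_r.
move=> t; apply: continuous_comp; last exact: sc.
by apply: continuous_max; [exact: cst_continuous | apply: continuous_min;
  [exact: cvg_id | exact: cst_continuous]].
Qed.

Lemma integrable_01 (s : R -> R) :
  (forall t, 0 <= t <= 1 -> {for t, continuous s}) ->
  mu.-integrable `[0, 1] (EFin \o s).
Proof.
move=> /clamp_continuous[s' s'c s's].
have := @continuous_integrable s' 0 1 s'c; apply: eq_integrable => // t.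
by rewrite inE /= in_itv /= => /s's ->.
Qed.

(* A Dini-derivative bound integrates: [K \int s + e t - phi t] is locally nondecreasing. *)
Lemma dini_le_integral (phi s : R -> R) (K : R) : 0 <= K ->
  (forall t, 0 <= t <= 1 -> {for t, continuous s}) ->
  (forall t e : R, 0 <= t <= 1 -> 0 < e ->
    \forall u \near t, `|phi u - phi t| <= (K * s t + e) * `|u - t|) ->
  phi 1 - phi 0 <= K * \int[mu]_(t in `[0, 1]) s t.
Proof.
move=> K0 /clamp_continuous[s' s'c s's] phi_dini.
rewrite (_ : \int[mu]_(t in _) s t = \int[mu]_(t in `[0, 1]) s' t); last first.
  by apply: eq_Rintegral => t; rewrite inE /= in_itv /= => /s's.
(* Starting at $-1$, and ending at 2 below, makes 0 and 1 interior points, so that [F] has a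
   two-sided derivative on all of [[0, 1]]. *)
pose F x := \int[mu]_(t in `[-1, x]) s' t.
have F01 : \int[mu]_(t in `[0, 1]) s' t = F 1 - F 0.
  rewrite /F Rintegral_itvB ?bnd_simp //; last exact: continuous_integrable.
  rewrite Rintegral_itv_obnd_cbnd //.
  apply: integrableS (@continuous_integrable s' 0 1 s'c) => //.
  by apply: subset_itvr; rewrite bnd_simp.
have dF (t : R) : 0 <= t <= 1 -> is_derive t 1 F (s' t).
  move=> /andP[t0 t1].
  have [||Fd Ft] := @continuous_FTC1_closed R s' (-1) t 2 _ (@continuous_integrable s' _ _ s'c) _ (s'c t).
  - by rewrite (le_lt_trans t1) // ltr1n.
  - by rewrite (lt_le_trans _ t0) // ltrN10.
  exact: (DeriveDef Fd (etrans (esym (derive1E F t)) Ft)).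
rewrite F01; apply/ler_addgt0Pr => e e0.
suff : K * F 0 + e * 0 - phi 0 <= K * F 1 + e * 1 - phi 1 by lra.
apply: (@locally_ndecr (fun t => K * F t + e * t - phi t)) => // t t01.
(* The error in [F] is multiplied by [K] and the error in [phi] counts once: together
   [(K + 1) * e' = e]. *)
pose e' := e / (K + 1).
have K1 : 0 < K + 1 by lra.
have e'0 : 0 < e' by rewrite divr_gt0.
have ee' : e = e' * (K + 1) by rewrite /e' divfK // gt_eqF.
have Fd := dF t t01.
have /(derivable1_diffP F t) Fdiff : derivable F t 1 by [].
have FtE (h : R) : 'd F t h = h * s' t.
  by rewrite deriv1E // derive1E derive_val.
have n1 := diff_approx_near Fdiff e'0.
near=> u.
have : `|F u - F t - 'd F t (u - t)| <= e' * `|u - t| by near: u.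
have : `|phi u - phi t| <= (K * s' t + e') * `|u - t|.
  by near: u; rewrite s's //; exact: phi_dini.
rewrite FtE ler_norml => /andP[h1 h2]; rewrite ler_norml => /andP[h3 h4].
have [ut|ut] := leP t u.
  rewrite ger0_norm ?subr_ge0 // in h1 h2 h3 h4.
  rewrite mulr_ge0 ?subr_ge0 //.
  have : K * ((u - t) * s' t - e' * (u - t)) <= K * (F u - F t) by rewrite ler_wpM2l //; lra.
  by rewrite -subr_ge0 ee'; lra.
rewrite ltr0_norm ?subr_lt0 // in h1 h2 h3 h4.
rewrite nmulr_lge0 ?subr_lt0 //.
have : K * (F u - F t) <= K * ((u - t) * s' t - e' * (u - t)) by rewrite ler_wpM2l //; lra.
by rewrite -subr_ge0 ee'; lra.
Unshelve. all: by end_near. Qed.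

End LocalMonotony.

Lemma cvg_nrm (R : realType) (n : nat) (T : Type) (F : set_system T) {FF : Filter F}
    (S : T -> 'M[R]_n) (v : T -> 'rV[R]_n) (S0 : 'M[R]_n) (v0 : 'rV[R]_n) :
  S @ F --> S0 -> v @ F --> v0 ->
  (fun t => nrm (S t) (v t)) @ F --> nrm S0 v0.
Proof.
move=> SS vv.
have cS i j : (fun t => S t i j) @ F --> S0 i j.
  apply: (@cvg_comp _ _ _ S (fun M : 'M[R]_n => M i j) F (nbhs S0)) => //.
  exact: matrix_normedtype.coord_continuous.
have cv j : (fun t => v t ord0 j) @ F --> v0 ord0 j.
  apply: (@cvg_comp _ _ _ v (fun M : 'rV[R]_n => M ord0 j) F (nbhs v0)) => //.
  exact: matrix_normedtype.coord_continuous.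
have bilE (U : 'M[R]_n) (w : 'rV[R]_n) :
    bilin U w w = \sum_j (\sum_i w ord0 i * U i j) * w ord0 j.
  by rewrite /bilin mxE; apply: eq_bigr => j _; rewrite !mxE.
apply: (@cvg_comp _ _ _ (fun t => bilin (S t) (v t) (v t)) Num.sqrt F
  (nbhs (bilin S0 v0 v0))); last exact: sqrt_continuous.
rewrite bilE; under eq_fun do rewrite bilE.
apply: cvg_big => [|j _]; first exact: add_continuous.
apply: cvgM; last exact: cv.
apply: cvg_big => [|i _]; first exact: add_continuous.
by apply: cvgM; [exact: cv | exact: cS].
Qed.

Section Curves.
Context {R : realType} {n : nat} {M : topologicalType} {A : smooth_atlas R n M}.
Variable g : riemannian_metric A.

(** [speed] reads the velocity in the chart chosen at [c t], which may jump with [t]. Continuity has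
    to be argued in one fixed chart, and [chart_change] shows that the value is the same. *)
Definition chart_nrm (i : chart A) (z : M) (v : 'rV[R]_n) : R :=
  nrm (gram g i (coord i z)) v.

Lemma transition_open (i j : chart A) : open (cod i `&` param i @^-1` dom j).
Proof.
rewrite openE => x [ci dj].
have di : nbhs x (cod i) by apply: open_nbhs_nbhs; split=> //; exact: cod_open.
have nj : nbhs x (param i @^-1` dom j).
  apply: (param_continuous ci); apply: open_nbhs_nbhs; split => //.
  exact: dom_open.
exact: filterI di nj.
Qed.

Lemma chart_change (i j : chart A) (c : R -> M) (t : R) :
  (\forall s \near t, dom i (c s)) -> dom j (c t) ->
  differentiable (coord i \o c) t ->
  differentiable (coord j \o c) t /\
  chart_nrm j (c t) (derive1 (coord j \o c) t) =
  chart_nrm i (c t) (derive1 (coord i \o c) t).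
Proof.
move=> di dj dc; have dit := nbhs_singleton di.
pose T := coord j \o param i.
have cx := coord_cod dit.
have djx : dom j (param i (coord i (c t))) by rewrite coordK.
have [/(_ _ (conj cx djx)) dT _] := @transition_smooth _ _ _ A i j 1%N.
have eqc : \forall s \near t, (T \o (coord i \o c)) s = (coord j \o c) s.
  by apply: filterS di => s ds; rewrite /T /= coordK.
have [dj' djE] := near_eq_differentiable eqc (differentiable_comp dc dT).
split; first exact: dj'.
have dE : derive1 (coord j \o c) t = 'd T (coord i (c t)) (derive1 (coord i \o c) t).
  have e1 := derive1E' dj'.
  have e2 := derive1E' dc.
  have e3 : 'd (coord j \o c) t 1 = 'd (T \o (coord i \o c)) t 1 := congr1 (@^~ 1) djE.
  have e4 : 'd (T \o (coord i \o c)) t 1 = 'd T (coord i (c t)) ('d (coord i \o c) t 1) :=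
    congr1 (@^~ 1) (diff_comp dc dT).
  by rewrite e1 e3 e4 e2.
have TE : T (coord i (c t)) = coord j (c t) by rewrite /T /= coordK.
set w := derive1 (coord i \o c) t in dE *.
have gE : bilin (gram g i (coord i (c t))) w w =
    bilin (gram g j (T (coord i (c t)))) ('d T (coord i (c t)) w) ('d T (coord i (c t)) w).
  by have h := gram_transition g cx djx w w; exact: h.
by rewrite /chart_nrm /nrm gE TE dE.
Qed.

Lemma speedE (i : chart A) (c : R -> M) (t : R) :
  (\forall s \near t, dom i (c s)) -> differentiable (coord i \o c) t ->
  speed g c t = chart_nrm i (c t) (derive1 (coord i \o c) t).
Proof.
move=> di dc; have [_ <-] := chart_change di (chart_atP A (c t)) dc.
by [].
Qed.

Lemma chart_nrm_cvg (i : chart A) (T : Type) (F : set_system T) {FF : Filter F}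
    (z : T -> M) (v : T -> 'rV[R]_n) (z0 : M) (v0 : 'rV[R]_n) :
  dom i z0 -> (coord i \o z) @ F --> coord i z0 -> v @ F --> v0 ->
  (fun t => chart_nrm i (z t) (v t)) @ F --> chart_nrm i z0 v0.
Proof.
move=> di zz vv; apply: cvg_nrm => //.
apply: (@cvg_comp _ _ _ (coord i \o z) (gram g i) F (nbhs (coord i z0))) => //.
exact: (gram_smooth g i 0%N _ (coord_cod di)).
Qed.

Section Arc.
Variable c : R -> M.
Hypothesis c_smooth : smooth_arc A c.

Lemma smooth_arc_near (t : R) : 0 <= t <= 1 -> let i := chart_at A (c t) in
  \forall s \near t, [/\ (\forall r \near s, dom i (c r)),
    differentiable (coord i \o c) s &
    {for s, continuous (derive1 (coord i \o c))}].
Proof.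
move=> t01 i; have [U [Uo Ut Udom Usm]] := c_smooth t01.
apply: filterS (open_nbhs_nbhs (conj Uo Ut)) => s Us; split.
- apply: filterS (open_nbhs_nbhs (conj Uo Us)) => r Ur; apply: Udom; by exists r.
- by have [/(_ s Us)] := Usm 1%N.
have [_ /(_ 1) [/(_ s Us) /differentiable_continuous]] := Usm 2%N.
by rewrite (_ : 'D_1 (coord i \o c) = derive1 (coord i \o c)) //;
  apply/funext => r; rewrite derive1E.
Qed.

Lemma arc_continuous (t : R) : 0 <= t <= 1 -> {for t, continuous c}.
Proof.
move=> t01; have /nbhs_singleton[/= dc /differentiable_continuous cc _] := smooth_arc_near t01.
have cxt : cod (chart_at A (c t)) (coord (chart_at A (c t)) (c t)).
  by apply: coord_cod; exact: chart_atP.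
have h : (param (chart_at A (c t)) \o (coord (chart_at A (c t)) \o c)) @ t -->
    param (chart_at A (c t)) (coord (chart_at A (c t)) (c t)).
  apply: (@cvg_comp _ _ _ (coord (chart_at A (c t)) \o c) (param (chart_at A (c t)))
    _ (nbhs (coord (chart_at A (c t)) (c t)))) => //.
  exact: (param_continuous cxt).
rewrite (coordK (chart_atP A (c t))) in h.
apply: cvg_trans h; apply: near_eq_cvg.
by apply: filterS dc => s ds /=; rewrite coordK.
Qed.

Lemma speed_continuous (t : R) : 0 <= t <= 1 -> {for t, continuous (speed g c)}.
Proof.
move=> t01; set i := chart_at A (c t).
have near_t := smooth_arc_near t01.
have [/= dc dif dcont] := nbhs_singleton near_t.
have sE : \forall s \near t, chart_nrm i (c s) (derive1 (coord i \o c) s) = speed g c s.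
  by apply: filterS near_t => s [ds difs _]; rewrite (speedE ds difs).
have h : (fun s => chart_nrm i (c s) (derive1 (coord i \o c) s)) @ t -->
    chart_nrm i (c t) (derive1 (coord i \o c) t).
  apply: chart_nrm_cvg dcont; first exact: chart_atP.
  exact: (differentiable_continuous dif).
suff : speed g c @ t --> speed g c t by [].
rewrite -(nbhs_singleton sE); apply: cvg_trans h; exact: near_eq_cvg.
Qed.

End Arc.
End Curves.

(** * Lower bounds on lengths *)

Lemma minr_lipschitz (R : realFieldType) (a b r : R) :
  `|Num.min a r - Num.min b r| <= `|a - b|.
Proof.
wlog ab : a b / a <= b.
  by move=> H; have [/H//|/ltW/H] := leP a b; rewrite distrC (distrC a).
have mm : Num.min a r <= Num.min b r by rewrite le_min ge_min ab /= ge_min lexx orbT.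
rewrite distrC (distrC a) !ger0_norm ?subr_ge0 //.
by have [ar|ar] := leP a r; have [br|br] := leP b r; lra.
Qed.

Lemma metric_hausdorff_space (R : realType) (M : topologicalType) (d : M -> M -> R) :
  is_metric d -> induces_topology d -> hausdorff_space M.
Proof.
move=> [d_ge0 d_eq0 d_sym d_tri] d_top x y xy; apply/d_eq0.
apply/eqP; rewrite eq_le d_ge0 andbT leNgt; apply/negP => dxy.
have e0 : 0 < d x y / 2 by rewrite divr_gt0.
have nx : nbhs x [set z | d x z < d x y / 2] by apply/d_top; exists (d x y / 2).
have ny : nbhs y [set z | d y z < d x y / 2] by apply/d_top; exists (d x y / 2).
have [z [/= xz yz]] := xy _ _ nx ny.
have := d_tri x z y; rewrite (d_sym z y) leNgt => /negP; apply.
by rewrite [ltRHS]splitr ltrD.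
Qed.

Section Lengths.
Context {R : realType} {n : nat} {M : topologicalType} {A : smooth_atlas R n M}.
Variable g : riemannian_metric A.

(** A test function [h] bounds lengths from below: [dini_le_integral] handles one arc, and both
    sides add up under concatenation. *)
Lemma joined_dini (h : M -> R) (K : R) : 0 <= K ->
  (forall c (t e : R), smooth_arc A c -> 0 <= t <= 1 -> 0 < e ->
    \forall u \near t, `|h (c u) - h (c t)| <= (K * speed g c t + e) * `|u - t|) ->
  forall x y l, joined g x y l -> h y - h x <= K * l.
Proof.
move=> K0 hK x y l; elim=> [c cs|x' y' z' k l' _ IH1 _ IH2].
  apply: (@dini_le_integral _ (h \o c)) => // [t|t e]; first exact: speed_continuous.
  exact: hK.
by rewrite mulrDr; lra.
Qed.

Section Capped.
Variables (i : chart A) (S : 'M[R]_n) (x : 'rV[R]_n) (r K : R).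
Hypotheses (S_sym : S^T = S) (S_pos : forall v, v != 0 -> 0 < bilin S v v).
Hypotheses (M_hausdorff : hausdorff_space M) (K0 : 0 <= K).
Hypothesis ball_cod : forall u, nrm S (u - x) <= r -> cod i u.
Hypothesis ball_nrm : forall u, nrm S (u - x) <= r ->
  forall v, nrm S v <= K * nrm (gram g i u) v.

(* Being constant off a compact ball of the chart, it is globally defined, and
   curves leaving the chart need no separate treatment. *)
Definition capped_dist (z : M) : R :=
  if `[< dom i z >] then Num.min (nrm S (coord i z - x)) r else r.

Lemma ball_compact : compact [set u | nrm S (u - x) <= r].
Proof.
have [c c0 cS] := norm_le_nrm S_sym S_pos.
apply: bounded_closed_compact.
  exists (`|x| + c * r); split; first exact: num_real.
  move=> b rb u /= ur; rewrite -(subrK x u) (le_trans (ler_normD _ _)) //.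
  rewrite addrC (le_trans _ (ltW rb)) // lerD2l (le_trans (cS _)) //.
  by rewrite ler_wpM2l // ltW.
rewrite (_ : mkset _ = (fun u => nrm S (u - x)) @^-1` [set y | y <= r]) //.
apply: closed_comp => [u _|]; last exact: closed_le.
apply: (@continuous_comp _ _ _ (fun u : 'rV[R]_n => u - x) (nrm S)).
  exact: (@cvgB _ _ _ (nbhs u) _ id (cst x) u x (@cvg_id _ (nbhs u)) (cvg_cst x)).
exact: nrm_continuous.
Qed.

(** A compact set in a Hausdorff space is closed. A curve at a point off this image therefore stays
    off it for a while, with [capped_dist] constant along it. *)
Lemma ball_image_closed : closed (param i @` [set u | nrm S (u - x) <= r]).
Proof.
apply: compact_closed => //; apply: continuous_compact; last exact: ball_compact.
apply: continuous_in_subspaceT => u /set_mem ur.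
exact: (param_continuous (ball_cod ur)).
Qed.

Lemma capped_dist_in (z : M) :
  dom i z -> capped_dist z = Num.min (nrm S (coord i z - x)) r.
Proof. by move=> dz; rewrite /capped_dist; case: asboolP. Qed.

Lemma capped_dist_out (z : M) :
  ~ (param i @` [set u | nrm S (u - x) <= r]) z -> capped_dist z = r.
Proof.
move=> nz; rewrite /capped_dist; case: asboolP => // dz.
apply/min_r/ltW; rewrite ltNge; apply/negP => zr; apply: nz.
by exists (coord i z) => //; rewrite coordK.
Qed.

Lemma capped_dist_dini c (t e : R) : smooth_arc A c -> 0 <= t <= 1 -> 0 < e ->
  \forall u \near t,
    `|capped_dist (c u) - capped_dist (c t)| <= (K * speed g c t + e) * `|u - t|.
Proof.
move=> cs t01 e0.
have cc := arc_continuous cs t01.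
have rhs_ge0 (u : R) : 0 <= (K * speed g c t + e) * `|u - t|.
  by rewrite mulr_ge0 // addr_ge0 ?(ltW e0) // mulr_ge0 // sqrtr_ge0.
(* Off the image of the ball the function equals [r] near [t]. On it, the chart covers a whole
   neighborhood and capping is 1-Lipschitz, so leaving the ball within the chart needs no separate
   case. *)
have [inP|outP] := pselect ((param i @` [set u | nrm S (u - x) <= r]) (c t)); last first.
  have : \forall u \near t, (~` (param i @` [set u | nrm S (u - x) <= r])) (c u).
    apply: cc; apply: open_nbhs_nbhs; split=> //.
    exact/closed_openC/ball_image_closed.
  apply: filterS => u /capped_dist_out ->.
  by rewrite capped_dist_out // subrr normr0.
have [w /= wr wE] := inP.
have dit : dom i (c t) by rewrite -wE; apply: param_dom; exact: ball_cod.
have ctE : coord i (c t) = w by rewrite -wE paramK //; exact: ball_cod.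
have di : \forall u \near t, dom i (c u).
  by apply: cc; apply: open_nbhs_nbhs; split=> //; exact: dom_open.
have [dcj djt _] := nbhs_singleton (smooth_arc_near cs t01).
have [dc cn] := chart_change g dcj dit djt.
have [k k0 kS] := nrm_le_norm S_pos.
have e'0 : 0 < e / k by rewrite divr_gt0.
have n1 := diff_approx_near dc e'0.
near=> u.
have diu : dom i (c u) by near: u.
rewrite (capped_dist_in diu) (capped_dist_in dit).
apply: le_trans (minr_lipschitz _ _ _) _.
apply: le_trans (nrmB_ge S_sym S_pos _ _) _.
have -> : coord i (c u) - x - (coord i (c t) - x) = coord i (c u) - coord i (c t).
  by rewrite opprB addrA subrK.
rewrite -(subrK ('d (coord i \o c) t (u - t)) (coord i (c u) - coord i (c t))).
apply: le_trans (nrmD S_sym S_pos _ _) _; rewrite addrC mulrDl; apply: lerD.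
  have -> : 'd (coord i \o c) t (u - t) = (u - t) *: derive1 (coord i \o c) t.
    by have h := congr1 (@^~ (u - t)) (diff1E dc); exact: h.
  rewrite nrmZ mulrC; apply: ler_wpM2r; first exact: normr_ge0.
  rewrite (speedE g di dc) /chart_nrm ctE; exact: ball_nrm.
apply: le_trans (kS _) _; rewrite -(ler_pdivlMl _ _ k0) mulrA (mulrC k^-1).
by near: u.
Unshelve. all: by end_near. Qed.

(** The test function vanishes at the centre and reaches its cap [r] on the sphere, whatever route
    the curve takes. *)
Lemma joined_capped u y l : 0 <= r -> nrm S (u - x) = r -> y = param i u ->
  joined g (param i x) y l -> r <= K * l.
Proof.
move=> r0 ur -> jl.
have := joined_dini K0 capped_dist_dini jl.
have cx : cod i x by apply: ball_cod; rewrite subrr nrm0.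
have cu : cod i u by apply: ball_cod; rewrite ur.
rewrite (capped_dist_in (param_dom cx)) (capped_dist_in (param_dom cu)).
by rewrite !paramK // subrr nrm0 ur minxx min_l // subr0.
Qed.

End Capped.
End Lengths.

(** * Straight segments in a chart *)

Section Segment.
Context {R : realType} {n : nat} {M : topologicalType} {A : smooth_atlas R n M}.
Variable g : riemannian_metric A.
Variables (i : chart A) (x v : 'rV[R]_n).
Hypothesis seg_cod : forall s : R, 0 <= s <= 1 -> cod i (x + s *: v).

Let c (s : R) := param i (x + s *: v).

Lemma segment_smooth : smooth_arc A c.
Proof.
move=> t t01 j.
pose B := cod i `&` param i @^-1` dom j.
have Bo : open B by exact: transition_open.
exists [set s : R | B (x + s *: v)]; split.
- apply: (open_comp (f := fun s : R => x + s *: v)) => // s _.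
  exact: line_continuous.
- split; [exact: seg_cod | exact: chart_atP].
- by move=> _ [s [_ Bs] <-].
by move=> k; exact: (Ck_line x v Bo (@transition_smooth _ _ _ A i j k)).
Qed.

Lemma segment_chart (t : R) : 0 <= t <= 1 ->
  \forall s \near t, coord i (c s) = x + s *: v /\ dom i (c s).
Proof.
move=> t01; have : \forall s \near t, cod i (x + s *: v).
  apply: (@line_continuous _ _ x v t); apply: open_nbhs_nbhs; split; first exact: cod_open.
  exact: seg_cod.
by apply: filterS => s cs; split; [exact: paramK | exact: param_dom].
Qed.

Lemma segment_speed (t : R) : 0 <= t <= 1 ->
  speed g c t = nrm (gram g i (x + t *: v)) v.
Proof.
move=> t01; have near_t := segment_chart t01.
have lE : \forall s \near t, x + s *: v = (coord i \o c) s.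
  by apply: filterS near_t => s [].
have [ld lD] := line_is_diff x v t.
have [dc dE] := near_eq_differentiable lE ld.
have di : \forall s \near t, dom i (c s) by apply: filterS near_t => s [].
have e0 : x + t *: v = coord i (c t) by exact: nbhs_singleton lE.
rewrite (speedE g di dc) /chart_nrm -e0.
congr (nrm _ _).
have e1 := derive1E' dc.
have e2 : 'd (coord i \o c) t 1 = 1 *: v.
  by have h := congr1 (@^~ 1) (etrans dE lD); exact: h.
by rewrite e1 e2 scale1r.
Qed.

Lemma segment_joined (K : R) :
  (forall s : R, 0 <= s <= 1 -> nrm (gram g i (x + s *: v)) v <= K) ->
  exists2 l, joined g (param i x) (param i (x + v)) l & l <= K.
Proof.
move=> segK; exists (arc_length g c).
  have := joined_arc g segment_smooth.
  by rewrite /c scale0r addr0 scale1r.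
have sc (t : R) : 0 <= t <= 1 -> {for t, continuous (speed g c)}.
  by move=> t01; apply: speed_continuous t01; exact: segment_smooth.
rewrite /arc_length (_ : K = \int[lebesgue_measure]_(t in `[0, 1]) (cst K t)).
  apply: le_Rintegral => //; first exact: integrable_01.
    by apply: integrable_01 => t _; exact: cst_continuous.
  by move=> t; rewrite /= in_itv /= => t01; rewrite (segment_speed t01); exact: segK.
have mu01 : fine (@lebesgue_measure R `[0, 1]%classic) = 1.
  have e := @lebesgue_measure_itv R `[0, 1].
  by rewrite /= lte_fin ltr01 oppr0 adde0 in e; have h := congr1 fine e; exact: h.
by rewrite Rintegral_cst // mu01 mulr1.
Qed.

End Segment.

(** * The distance near a point *)

(** The second bound rests on $(1+s)^2(1-s)\ge 1$, that is $s(1-s-s^2)\ge 0$, which is where $s\le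
    1/2$ is used. *)
Lemma sqr_close (R : realFieldType) (a b s : R) :
  0 <= a -> 0 <= b -> 0 <= s <= 2^-1 -> `|a ^+ 2 - b ^+ 2| <= s * b ^+ 2 ->
  a <= (1 + s) * b /\ b <= (1 + s) * a.
Proof.
move=> a0 b0 /andP[s0 s1]; rewrite ler_norml => /andP[h1 h2].
have s2 : s <= 1 / 2 by rewrite div1r.
have bb : 0 <= b ^+ 2 by rewrite sqr_ge0.
have sb : 0 <= s * b ^+ 2 by rewrite mulr_ge0.
have ssb : 0 <= s * (s * b ^+ 2) by rewrite mulr_ge0.
have s10 : 0 <= 1 + s by rewrite addr_ge0.
split.
  rewrite -ler_sqr ?nnegrE //; last by rewrite mulr_ge0.
  by rewrite exprMn sqrrD expr1n mul1r mulr2n; lra.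
rewrite -ler_sqr ?nnegrE //; last by rewrite mulr_ge0.
rewrite exprMn; apply: (@le_trans _ _ ((1 + s) ^+ 2 * (b ^+ 2 - s * b ^+ 2))).
  rewrite -subr_ge0 (_ : _ - _ = s * b ^+ 2 * (1 - s - s * s)); last by ring.
  rewrite mulr_ge0 //; have : s * s <= 1 / 2 * (1 / 2) by apply: ler_pM.
  lra.
by rewrite ler_wpM2l ?sqr_ge0 //; lra.
Qed.

Section NearIsometry.
Context {R : realType} {n : nat} {M : topologicalType} {A : smooth_atlas R n M}.
Variables (g : riemannian_metric A) (d : M -> M -> R).
Hypotheses (d_metric : is_metric d) (d_top : induces_topology d)
  (d_geo : restricts_to_geodesic_dist g d).
Variables (i : chart A) (x0 : 'rV[R]_n).
Hypothesis cod_x0 : cod i x0.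

Let S := gram g i x0.

Let S_sym : S^T = S := gram_sym g cod_x0.
Let S_pos := gram_posdef g cod_x0.

Lemma nrm_nbhs (P : set 'rV[R]_n) : nbhs x0 P ->
  exists2 r, 0 < r & forall u, nrm S (u - x0) < r -> P u.
Proof.
have [c c0 cS] := norm_le_nrm S_sym S_pos.
move=> /nbhs_ballP[e /= e0 eP]; exists (c^-1 * e); first by rewrite mulr_gt0 ?invr_gt0.
move=> u ur; apply: eP; rewrite -ball_normE /=.
rewrite distrC; apply: le_lt_trans (cS _) _.
by rewrite -ltr_pdivlMl.
Qed.

Lemma gram_lipschitz : exists C r, [/\ 0 < C, 0 < r & forall u, nrm S (u - x0) < r ->
  cod i u /\ forall v,
    nrm (gram g i u) v <= (1 + C * nrm S (u - x0)) * nrm S v /\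
    nrm S v <= (1 + C * nrm S (u - x0)) * nrm (gram g i u) v].
Proof.
have [c c0 cS] := norm_le_nrm S_sym S_pos.
have [/(_ _ cod_x0) dg _] := gram_smooth g i 1%N.
have [L L0 dL] := linear_lipschitz (diff_continuous dg).
have n1 := diff_approx_near dg ltr01.
have n2 : nbhs x0 (cod i) by apply: open_nbhs_nbhs; split=> //; exact: cod_open.
have [r r0 rP] := nrm_nbhs (filterI n1 n2).
(* [n%:R ^+ 2] comes from [bilin_le] and [1 + L] from the first-order expansion of the Gram matrix
   at [x0] with error 1. Each [c] turns an ambient norm into [nrm S]: once for [u - x0], twice for
   [v]. The radius [2^-1 / C] below is what [sqr_close] asks for. *)
pose C := n%:R ^+ 2 * (1 + L) * c ^+ 3 + 1.
have C0 : 0 < C.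
  by apply: ltr_wpDl => //; rewrite !mulr_ge0 ?exprn_ge0 ?addr_ge0 ?(ltW c0) ?(ltW L0).
exists C, (Num.min r (2^-1 / C)); split => //.
  by rewrite lt_min r0 divr_gt0 // invr_gt0.
move=> u; rewrite lt_min => /andP[ur uC]; have [/= ug uc] := rP u ur.
split => // v; apply: sqr_close; rewrite ?nrm_ge0 //.
  by rewrite mulr_ge0 ?nrm_ge0 ?(ltW C0) // mulrC -ler_pdivlMr // ltW.
rewrite (sqr_nrm S_pos) sqr_nrm; last exact: gram_posdef.
rewrite -bilin_subM -(sqr_nrm S_pos); apply: le_trans (bilin_le _ _ _) _.
have gS : `|gram g i u - S| <= (1 + L) * (c * nrm S (u - x0)).
  have Lu : 0 <= 1 + L by rewrite addr_ge0 ?(ltW L0).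
  apply: le_trans (_ : (1 + L) * `|u - x0| <= _); last exact: ler_wpM2l (cS _).
  rewrite -(subrK ('d (gram g i) x0 (u - x0)) (gram g i u - S)).
  by apply: le_trans (ler_normD _ _) _; rewrite mulrDl; apply: lerD => //; exact: dL.
apply: (@le_trans _ _ (n%:R ^+ 2 * ((1 + L) * (c * nrm S (u - x0))) * (c * nrm S v) * (c * nrm S v))).
  by rewrite !ler_pM ?mulr_ge0 ?exprn_ge0.
have : 0 <= nrm S (u - x0) * nrm S v ^+ 2 by rewrite mulr_ge0 ?sqr_ge0 ?nrm_ge0.
by rewrite /C -subr_ge0 => h; rewrite (_ : _ - _ = nrm S (u - x0) * nrm S v ^+ 2) //; ring.
Qed.

Lemma geodesic_le (x y : M) (l : R) : connected_component [set: M] x y ->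
  joined g x y l -> d x y <= l.
Proof.
move=> /d_geo xy jl; rewrite -lee_fin xy; apply: ereal_inf_lbound.
by exists l.
Qed.

Lemma geodesic_ge (x y : M) (b : R) : connected_component [set: M] x y ->
  (forall l, joined g x y l -> b <= l) -> b <= d x y.
Proof.
move=> /d_geo xy jl; rewrite -lee_fin xy; apply: le_ereal_inf_tmp => _ [l jxy <-].
by rewrite lee_fin; exact: jl.
Qed.

Theorem near_isometry : exists C r, [/\ 0 < C, 0 < r,
  forall u, nrm S (u - x0) < r -> cod i u &
  forall rho u w, rho < r -> nrm S (u - x0) <= rho -> nrm S (w - x0) <= rho ->
    d (param i u) (param i w) <= (1 + C * rho) * nrm S (u - w) /\
    nrm S (u - w) <= (1 + C * rho) * d (param i u) (param i w)].
Proof.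
have [C [r [C0 r0 Cr]]] := gram_lipschitz.
(* The ball about [u] of radius [nrm S (u - w)], itself at most [2 * rho], stays within [3 * rho] of
   [x0]. *)
exists (3 * C), (r / 3); split; rewrite ?mulr_gt0 ?divr_gt0 //.
  by move=> u ur; have [] // := Cr u; apply: lt_trans ur _; lra.
move=> rho u w rhor urho wrho.
have rho0 : 0 <= rho by apply: le_trans urho; exact: nrm_ge0.
have rhor' : rho < r by lra.
have Crho z v : nrm S (z - x0) <= 3 * rho ->
    nrm (gram g i z) v <= (1 + 3 * C * rho) * nrm S v /\
    nrm S v <= (1 + 3 * C * rho) * nrm (gram g i z) v.
  move=> zrho; have [|_ /(_ v)[h1 h2]] := Cr z; first by apply: le_lt_trans zrho _; lra.
  have le1 : 1 + C * nrm S (z - x0) <= 1 + 3 * C * rho.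
    have : C * nrm S (z - x0) <= C * (3 * rho) by rewrite ler_wpM2l // ltW.
    lra.
  by split; [apply: le_trans h1 _ | apply: le_trans h2 _]; rewrite ler_wpM2r ?nrm_ge0.
have seg (s : R) : 0 <= s <= 1 -> nrm S (u + s *: (w - u) - x0) <= rho.
  move=> /andP[s0 s1].
  have -> : u + s *: (w - u) - x0 = (1 - s) *: (u - x0) + s *: (w - x0).
    rewrite !scalerBl !scalerBr scale1r; apply/rowP => k; rewrite !mxE; ring.
  apply: le_trans (nrmD S_sym S_pos _ _) _; rewrite !nrmZ !ger0_norm ?subr_ge0 //.
  have h1 : (1 - s) * nrm S (u - x0) <= (1 - s) * rho by rewrite ler_wpM2l ?subr_ge0.
  have h2 : s * nrm S (w - x0) <= s * rho by rewrite ler_wpM2l.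
  lra.
have seg_cod (s : R) : 0 <= s <= 1 -> cod i (u + s *: (w - u)).
  by move=> s01; have [] // := Cr (u + s *: (w - u)); apply: le_lt_trans (seg s s01) _.
(* [d] is the geodesic distance only within a component; the segment shows that both points lie in
   the same one. *)
have conn : connected_component [set: M] (param i u) (param i w).
  exists ((fun s : R => param i (u + s *: (w - u))) @` `[0, 1]).
    split => //; first by exists 0; rewrite ?scale0r ?addr0 //= in_itv /= lexx ler01.
    apply: connected_continuous_connected; first exact: segment_connected.
    apply: continuous_in_subspaceT => s /set_mem; rewrite /= in_itv /= => s01.
    apply: (@continuous_comp _ _ _ (fun s : R => u + s *: (w - u)) (param i)).
      exact: line_continuous.
    exact: (param_continuous (seg_cod s s01)).
  by exists 1; rewrite ?scale1r ?(addrC u) ?subrK //= in_itv /= lexx ler01.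
have K0 : 0 <= 1 + 3 * C * rho by rewrite addr_ge0 // !mulr_ge0 ?(ltW C0).
split.
  have [|l jl lK] := @segment_joined _ _ _ _ g i u (w - u) seg_cod ((1 + 3 * C * rho) * nrm S (w - u)).
    move=> s s01; have [|h _] := Crho (u + s *: (w - u)) (w - u); last exact: h.
    by apply: le_trans (seg s s01) _; lra.
  rewrite addrC subrK in jl; rewrite nrmC.
  exact: le_trans (geodesic_le conn jl) lK.
rewrite mulrC -ler_pdivrMr; last by apply: ltr_wpDr => //; rewrite !mulr_ge0 ?(ltW C0).
apply: (geodesic_ge conn) => l jl; rewrite ler_pdivrMr; last first.
  by apply: ltr_wpDr => //; rewrite !mulr_ge0 ?(ltW C0).
rewrite mulrC.
have ballP z : nrm S (z - u) <= nrm S (u - w) -> nrm S (z - x0) <= 3 * rho.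
  move=> zu; apply: le_trans (nrm_tri S_sym S_pos z u x0) _.
  have := nrm_tri S_sym S_pos u x0 w; rewrite (nrmC _ x0 w); lra.
apply: (@joined_capped _ _ _ _ g i S u (nrm S (u - w)) _ S_sym S_pos
   (metric_hausdorff_space d_metric d_top) K0 _ _ w (param i w)) => //.
- by move=> z /ballP zr; have [] // := Cr z; apply: le_lt_trans zr _; lra.
- by move=> z /ballP zr v; have [_] := Crho z v zr.
- exact: nrm_ge0.
by rewrite nrmC.
Qed.

End NearIsometry.

(** * Differentiability of isometries at a fixed point *)

Section LinearOfIsometry.
Context {R : realType} {n : nat}.
Variable S : 'M[R]_n.
Hypotheses (S_sym : S^T = S) (S_pos : forall v, v != 0 -> 0 < bilin S v v).
Local Notation N := (nrm S).

(** Fixing 0 and preserving distances preserves inner products by polarization; then the squared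
    norm of [L (a *: x + y) - (a *: L x + L y)] expands to 0. *)
Lemma isometry_linear (L : 'rV[R]_n -> 'rV[R]_n) :
  L 0 = 0 -> (forall x y, N (L x - L y) = N (x - y)) ->
  exists2 L' : {linear 'rV[R]_n -> 'rV[R]_n}, continuous L' & L = L'.
Proof.
move=> L0 Liso.
have LN x : N (L x) = N x by rewrite -[L x]subr0 -L0 Liso subr0.
have LB x y : bilin S (L x) (L y) = bilin S x y.
  have := sqr_nrmB S_sym S_pos (L x) (L y); rewrite Liso !LN.
  rewrite (sqr_nrmB S_sym S_pos); lra.
have Llin : linear L.
  move=> a x y; apply/eqP; rewrite -subr_eq0; apply/eqP/(nrm_eq0 S_pos)/eqP.
  rewrite -sqrf_eq0 sqr_nrm //; apply/eqP.
  rewrite !(bilinDl, bilinDr, bilinZl, bilinZr, bilinNl, bilinNr) !LB.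
  rewrite !(bilinDl, bilinDr, bilinZl, bilinZr, bilinNl, bilinNr).
  by rewrite (bilinC y x S_sym); ring.
pose L' : {linear _ -> _} := HB.pack L (GRing.isLinear.Build _ _ _ _ _ Llin).
exists L' => // x; suff : L y @[y --> x] --> L x by [].
have [c c0 cS] := norm_le_nrm S_sym S_pos.
have [k k0 kS] := nrm_le_norm S_pos.
apply/(@cvgrPdist_le R _ _ (nbhs x)) => e e0; near=> y.
apply: le_trans (cS _) _; rewrite Liso -ler_pdivlMl //.
apply: le_trans (kS _) _; rewrite -ler_pdivlMl //.
have : ball x (k^-1 * (c^-1 * e)) y.
  by near: y; apply: nbhsx_ballx; rewrite !mulr_gt0 ?invr_gt0.
by rewrite -ball_normE /= => /ltW.
Unshelve. all: by end_near. Qed.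

(* Think of [D] as [576 C]: large numerals are unary. *)
Variables (F : 'rV[R]_n -> 'rV[R]_n) (C D r : R).
Hypotheses (C0 : 0 < C) (r0 : 0 < r) (F0 : F 0 = 0).
Hypothesis F_near : forall rho u w, rho < r -> N u <= rho -> N w <= rho ->
  N (F u - F w) <= (1 + C * rho) * N (u - w) /\
  N (u - w) <= (1 + C * rho) * N (F u - F w).
Hypotheses (Cr1 : C * r <= 1) (CD : 12 * (48 * C) <= D).

Lemma D_ge0 : 0 <= D.
Proof. by apply: le_trans CD; rewrite !mulr_ge0 // ltW. Qed.
#[local] Hint Resolve D_ge0 : core.

(** Bounding the error by [N (u - w)] alone costs one more factor [1 + C * rho], at most 2 because
    [C * r <= 1]. *)
Lemma near_dist rho u w : rho < r -> N u <= rho -> N w <= rho ->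
  `|N (F u - F w) - N (u - w)| <= 2 * C * rho * N (u - w).
Proof.
move=> rr ur wr; have [h1 h2] := F_near rr ur wr.
have rho0 : 0 <= rho by apply: le_trans ur; exact: nrm_ge0.
have Crho : 0 <= C * rho by rewrite mulr_ge0 // ltW.
have Crho1 : C * rho <= 1 by apply: le_trans Cr1; rewrite ler_wpM2l // ltW.
move: h1 h2 (nrm_ge0 S (F u - F w)) (nrm_ge0 S (u - w)).
move: (N (F u - F w)) (N (u - w)) => a b h1 h2 a0 b0.
have h3 : C * rho * a <= C * rho * ((1 + C * rho) * b) by rewrite ler_wpM2l.
have h4 : C * rho * (C * rho * b) <= 1 * (C * rho * b).
  by rewrite ler_wpM2r // mulr_ge0.
have h5 : 0 <= C * rho * b by rewrite mulr_ge0.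
by rewrite ler_norml; apply/andP; split; lra.
Qed.

Lemma near_sqr rho u w : rho < r -> N u <= rho -> N w <= rho ->
  `|N (F u - F w) ^+ 2 - N (u - w) ^+ 2| <= 32 * C * rho ^+ 3.
Proof.
move=> rr ur wr; have := near_dist rr ur wr.
have rho0 : 0 <= rho by apply: le_trans ur; exact: nrm_ge0.
have Crho : 0 <= C * rho by rewrite mulr_ge0 // ltW.
have Crho1 : C * rho <= 1 by apply: le_trans Cr1; rewrite ler_wpM2l // ltW.
have b2 : N (u - w) <= 2 * rho.
  by apply: le_trans (nrmD S_sym S_pos _ _) _; rewrite nrmN; lra.
move: b2 (nrm_ge0 S (F u - F w)) (nrm_ge0 S (u - w)).
move: (N (F u - F w)) (N (u - w)) => a b b2 a0 b0 ab.
have h5 : C * rho * b <= 1 * b by rewrite ler_wpM2r.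
have h6 : C * rho * b <= C * rho * (2 * rho) by rewrite ler_wpM2l.
have aab : a <= 3 * b by move: ab; rewrite ler_norml => /andP[]; lra.
have bb : 0 <= a + b <= 8 * rho by apply/andP; split; lra.
rewrite subr_sqr normrM (ger0_norm (proj1 (andP bb))).
(* Since [b <= 2 * rho], the difference is at most [2 * C * rho * b <= 4 * C * rho ^+ 2]; the sum is
   at most [4 * b <= 8 * rho]. Hence 32. *)
apply: le_trans (_ : 4 * C * rho ^+ 2 * (8 * rho) <= _).
  apply: ler_pM => //; last by case/andP: bb.
    by case/andP: bb.
  by apply: le_trans ab _; rewrite expr2; lra.
by rewrite le_eqVlt; apply/orP; left; apply/eqP; ring.
Qed.

(** Polarization combines three squares, each with error [32 * C * rho ^+ 3], and halves: 48. As
    [F 0 = 0], the norms of [F u] and [F w] are among the controlled distances. *)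
Lemma near_bilin rho u w : rho < r -> N u <= rho -> N w <= rho ->
  `|bilin S (F u) (F w) - bilin S u w| <= D / 12 * rho ^+ 3.
Proof.
move=> rr ur wr.
have rho0 : 0 <= rho by apply: le_trans ur; exact: nrm_ge0.
have z0 : N 0 <= rho by rewrite nrm0.
have Crho : 48 * C * rho ^+ 3 <= D / 12 * rho ^+ 3.
  by rewrite ler_wpM2r ?exprn_ge0 // ler_pdivlMr // mulrC.
have := near_sqr rr ur wr; have := near_sqr rr ur z0; have := near_sqr rr wr z0.
rewrite F0 !subr0 !(sqr_nrmB S_sym S_pos) !ler_norml.
by move=> /andP[a1 a2] /andP[b1 b2] /andP[c1 c2]; apply/andP; split; lra.
Qed.

(** Expanding the square, the main terms cancel as $1/4-1/2+1/4$. The errors add up to $1+1+1/4$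
    times that of [near_bilin], rounded up to 3 times. *)
Lemma near_half rho u : rho < r -> N u <= rho ->
  N (F (2^-1 *: u) - 2^-1 *: F u) ^+ 2 <= D / 4 * rho ^+ 3.
Proof.
move=> rr ur; have rho0 : 0 <= rho by apply: le_trans ur; exact: nrm_ge0.
have hr : N (2^-1 *: u) <= rho.
  by rewrite nrmZ ger0_norm ?invr_ge0 //; have := nrm_ge0 S u; lra.
have := near_bilin rr ur ur; have := near_bilin rr hr hr; have := near_bilin rr hr ur.
rewrite (sqr_nrmB S_sym S_pos) !(sqr_nrm S_pos) !(bilinZl, bilinZr) !ler_norml.
by move=> /andP[a1 a2] /andP[b1 b2] /andP[c1 c2]; lra.
Qed.

Definition dyadic (x : 'rV[R]_n) (k : nat) : 'rV[R]_n :=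
  2 ^+ k *: F (2^-1 ^+ k *: x).

(* By [near_half] the squared step is [O(2^-k)], hence bounded by [(3/4)^2k]. *)
Lemma dyadic_step x k : N (2^-1 ^+ k *: x) < r ->
  N (dyadic x k.+1 - dyadic x k) <=
  Num.sqrt (D * N x ^+ 3) * (3 / 4) ^+ k.
Proof.
move=> xr; have h := near_half xr (lexx _).
have p2 j : 0 < 2 ^+ j :> R by rewrite exprn_gt0.
have -> : dyadic x k.+1 - dyadic x k =
    2 ^+ k.+1 *: (F (2^-1 *: (2^-1 ^+ k *: x)) - 2^-1 *: F (2^-1 ^+ k *: x)).
  rewrite /dyadic scalerBr !scalerA -exprS; congr (_ - _ *: _).
  by rewrite exprS mulrAC mulfV ?mul1r // pnatr_eq0.
rewrite nrmZ gtr0_norm // -ler_sqr ?nnegrE; last 2 first.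
- by rewrite mulr_ge0 ?nrm_ge0 // ltW.
- by rewrite mulr_ge0 ?sqrtr_ge0 // exprn_ge0 //; lra.
have P0 : 0 <= D * N x ^+ 3 by rewrite mulr_ge0 ?exprn_ge0 ?nrm_ge0.
rewrite exprMn [leRHS]exprMn (sqr_sqrtr P0).
move: h; rewrite nrmZ ger0_norm ?exprn_ge0 ?invr_ge0 // => h.
have -> : (D * N x ^+ 3) * ((3 / 4) ^+ k) ^+ 2 =
   (2 ^+ k.+1) ^+ 2 * (D / 4 * (2^-1 ^+ k * N x) ^+ 3) * (9 / 8) ^+ k.
  have -> : (3 / 4 : R) ^+ k ^+ 2 = (2 ^+ k) ^+ 2 * (2^-1 ^+ k) ^+ 3 * (9 / 8) ^+ k.
    by rewrite -!exprM ![(k * _)%N]mulnC !exprM -!exprMn; congr (_ ^+ k); field.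
  by rewrite [2 ^+ k.+1]exprS; field.
rewrite -[leLHS]mulr1; apply: ler_pM => //.
- by rewrite mulr_ge0 // sqr_ge0.
- by rewrite ler_wpM2l // sqr_ge0.
by apply: exprn_ege1; lra.
Qed.

Lemma nrm_half_le x m : N (2^-1 ^+ m *: x) <= N x.
Proof.
rewrite nrmZ ger0_norm ?exprn_ge0 ?invr_ge0 //.
apply: ler_piMl; first exact: nrm_ge0.
by apply: exprn_ile1; rewrite ?invr_ge0 //; lra.
Qed.

(** The factor $4-4(3/4)^m$ is the exact sum of the first $m$ powers of $3/4$, the ratio in
    [dyadic_step]. *)
Lemma dyadic_bound x m : N x < r ->
  N (dyadic x m - F x) <= Num.sqrt (D * N x ^+ 3) * (4 - 4 * (3 / 4) ^+ m).
Proof.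
move=> xr; have s0 := sqrtr_ge0 (D * N x ^+ 3).
elim: m => [|m IH].
  by rewrite /dyadic !expr0 !scale1r subrr nrm0 mulr1 subrr mulr0.
have xm : N (2^-1 ^+ m *: x) < r by exact: le_lt_trans (nrm_half_le _ _) xr.
have := dyadic_step xm; have := nrm_tri S_sym S_pos (dyadic x m.+1) (dyadic x m) (F x).
rewrite [_ ^+ m.+1]exprS; move: IH; set q := (3 / 4) ^+ m; set s := Num.sqrt _.
have sq : s * (4 - 4 * (3 / 4 * q)) = s * (4 - 4 * q) + s * q by field.
by lra.
Qed.

Lemma half_eventually x e : 0 < e -> \forall k \near \oo, N (2^-1 ^+ k *: x) < e.
Proof.
move=> e0.
have : (fun k => 2^-1 ^+ k * N x) @ \oo --> (0 * N x : R).
  by apply: cvgMr_tmp; apply: cvg_expr; rewrite ger0_norm; lra.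
rewrite mul0r => /(cvgr_lt _) /(_ e e0); apply: filterS => k.
by rewrite nrmZ ger0_norm ?exprn_ge0 ?invr_ge0.
Qed.

(** For fixed [x] and [y], of any size, the relative error is $O(2^{-k})$, so that every pointwise
    limit of [dyadic] is an exact isometry. *)
Lemma dyadic_dist x y k : N (2^-1 ^+ k *: x) < r -> N (2^-1 ^+ k *: y) < r ->
  `|N (dyadic x k - dyadic y k) - N (x - y)| <=
  2 * C * (2^-1 ^+ k * (N x + N y)) * N (x - y).
Proof.
move=> xr yr.
have p2 : 0 < 2 ^+ k :> R by rewrite exprn_gt0.
have i2 : 0 <= 2^-1 ^+ k :> R by rewrite exprn_ge0 // invr_ge0.
have p2i : 2 ^+ k * 2^-1 ^+ k = 1 :> R by rewrite -exprMn divff ?expr1n // pnatr_eq0.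
pose rho := Num.max (N (2^-1 ^+ k *: x)) (N (2^-1 ^+ k *: y)).
have rr : rho < r by rewrite gt_max xr yr.
have xrho : N (2^-1 ^+ k *: x) <= rho by rewrite le_max lexx.
have yrho : N (2^-1 ^+ k *: y) <= rho by rewrite le_max lexx orbT.
have rhoxy : rho <= 2^-1 ^+ k * (N x + N y).
  rewrite ge_max !nrmZ ger0_norm // !ler_wpM2l //.
    by rewrite lerDr nrm_ge0.
  by rewrite lerDl nrm_ge0.
have := near_dist rr xrho yrho.
have -> : dyadic x k - dyadic y k = 2 ^+ k *: (F (2^-1 ^+ k *: x) - F (2^-1 ^+ k *: y)).
  by rewrite scalerBr.
rewrite -scalerBr !nrmZ (ger0_norm i2) (gtr0_norm p2) => h.
have -> (a b : R) : 2 ^+ k * a - b = 2 ^+ k * (a - 2^-1 ^+ k * b).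
  by rewrite mulrBr mulrA p2i mul1r.
rewrite normrM (gtr0_norm p2).
apply: le_trans (_ : 2 ^+ k * (2 * C * rho * (2^-1 ^+ k * N (x - y))) <= _).
  by rewrite ler_wpM2l // ltW.
have -> : 2 ^+ k * (2 * C * rho * (2^-1 ^+ k * N (x - y))) =
  2 ^+ k * 2^-1 ^+ k * (2 * C * rho * N (x - y)) by ring.
rewrite p2i mul1r; apply: ler_wpM2r; first exact: nrm_ge0.
by apply: ler_wpM2l => //; rewrite mulr_ge0 // ltW.
Qed.

Lemma near_linear : exists2 L : {linear 'rV[R]_n -> 'rV[R]_n}, continuous L &
  forall x, N x < r -> N (F x - L x) <= 4 * Num.sqrt (D * N x ^+ 3).
Proof.
(* A limit is needed at every [x], also beyond the radius of [dyadic_bound]; it is taken along the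
   ultrafilter, by compactness. Comparison with 0 and [C * r <= 1] keep [dyadic x k] within
   [3 * N x] for large [k]. *)
have dyadic_cvg x : exists l : 'rV[R]_n, (dyadic x) @ ultra_oo --> l.
  have [c c0 cS] := norm_le_nrm S_sym S_pos.
  pose K : set 'rV[R]_n := [set u | N (u - 0) <= 3 * N x].
  have [||l _ xl] := @compact_cvg_ultra_oo _ K (dyadic x); last by exists l.
    exact: ball_compact.
  apply: eventually_ultra_oo; apply: filterS (half_eventually x r0) => k xr.
  rewrite /K /= subr0.
  have := @dyadic_dist x 0 k xr; rewrite scaler0 nrm0 => /(_ r0).
  have -> : dyadic 0 k = 0 by rewrite /dyadic scaler0 F0 scaler0.
  rewrite !subr0 addr0 => h.
  have h1 : C * (2^-1 ^+ k * N x) <= 1.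
    apply: le_trans Cr1; rewrite ler_wpM2l ?(ltW C0) // ltW //.
    by move: xr; rewrite nrmZ ger0_norm ?exprn_ge0 ?invr_ge0.
  have h2 : C * (2^-1 ^+ k * N x) * N x <= 1 * N x by rewrite ler_wpM2r ?nrm_ge0.
  by move: h; rewrite ler_norml => /andP[]; lra.
have [L xL] := choice dyadic_cvg.
have L0 : L 0 = 0.
  apply: (cvg_unique (@norm_hausdorff _ _) (xL 0)).
  rewrite (_ : dyadic 0 = cst 0); first exact: cvg_cst.
  by apply/funext => k; rewrite /dyadic scaler0 F0 scaler0.
have Liso x y : N (L x - L y) = N (x - y).
  apply: (cvg_unique (@norm_hausdorff R R^o) (F := (fun k => N (dyadic x k - dyadic y k)) @ ultra_oo)).
    apply: (@cvg_comp _ _ _ (fun k => dyadic x k - dyadic y k) N ultra_oo (nbhs (L x - L y))).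
      by apply: cvgB; exact: xL.
    exact: nrm_continuous.
  apply: cvg_ultra_oo; apply/cvgrPdist_le => e e0.
  pose B := 2 * C * (N x + N y) * N (x - y) + 1.
  have B0 : 0 < B.
    by apply: ltr_wpDl => //; rewrite !mulr_ge0 ?addr_ge0 ?nrm_ge0 // ltW.
  have hk : \forall k \near \oo, (2^-1 ^+ k : R) < e / B.
    have : (fun k => 2^-1 ^+ k : R) @ \oo --> (0 : R).
      by apply: cvg_expr; rewrite ger0_norm; lra.
    by move=> /(cvgr_lt _); apply; rewrite divr_gt0.
  near=> k.
  have xr : N (2^-1 ^+ k *: x) < r by near: k; exact: half_eventually.
  have yr : N (2^-1 ^+ k *: y) < r by near: k; exact: half_eventually.
  rewrite distrC; apply: le_trans (dyadic_dist xr yr) _.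
  have kB : 2^-1 ^+ k * B <= e by rewrite -ler_pdivlMr // ltW //; near: k; exact: hk.
  apply: le_trans kB.
  rewrite (_ : 2^-1 ^+ k * B = 2^-1 ^+ k * (2 * C * (N x + N y) * N (x - y)) + 2^-1 ^+ k);
    last by rewrite /B; ring.
  have : 0 <= 2^-1 ^+ k :> R by rewrite exprn_ge0 // invr_ge0.
  rewrite (_ : 2 * C * (2^-1 ^+ k * (N x + N y)) * N (x - y) =
    2^-1 ^+ k * (2 * C * (N x + N y) * N (x - y))); last by ring.
  by rewrite lerDl.
have [L' L'c LE] := isometry_linear L0 Liso; exists L' => // x xr.
rewrite -LE nrmC; have h : (fun m => N (dyadic x m - F x)) @ ultra_oo --> N (L x - F x).
  apply: (@cvg_comp _ _ _ (fun k => dyadic x k - F x) N ultra_oo (nbhs (L x - F x))).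
    by apply: cvgB; [exact: xL | exact: cvg_cst].
  exact: nrm_continuous.
apply: (cvgr_to_le h); apply: filterE => m; apply: le_trans (dyadic_bound m xr) _.
rewrite mulrC ler_wpM2r ?sqrtr_ge0 //.
have : 0 <= (3 / 4 : R) ^+ m by rewrite exprn_ge0 //; lra.
lra.
Unshelve. all: by end_near. Qed.

End LinearOfIsometry.

(** * The differential of an isometry at a fixed point *)

Section Differential.
Context {R : realType} {n : nat} {M : topologicalType} {A : smooth_atlas R n M}.
Variables (g : riemannian_metric A) (d : M -> M -> R).
Hypotheses (d_metric : is_metric d) (d_top : induces_topology d)
  (d_geo : restricts_to_geodesic_dist g d).
Variable p : M.

Let i := chart_at A p.
Let x0 := coord i p.
Let S := gram g i x0.
Local Notation N := (nrm S).

(** This is the chart recentred at [p], not the exponential map: first-order agreement of the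
    metrics at 0 is enough here. *)
Definition normal_point (u : 'rV[R]_n) : M := param i (x0 + u).
Local Notation phi := normal_point.

Lemma chart_at_cod : cod i x0.
Proof. by apply: coord_cod; exact: chart_atP. Qed.

Let Ssym : S^T = S := gram_sym g chart_at_cod.
Let Spos := gram_posdef g chart_at_cod.

Lemma normal_point0 : phi 0 = p.
Proof. by rewrite /phi addr0 coordK //; exact: chart_atP. Qed.

Lemma normal_point_near : exists C r, [/\ 0 < C, 0 < r,
  forall u, N u < r -> cod i (x0 + u) &
  forall rho u w, rho < r -> N u <= rho -> N w <= rho ->
    d (phi u) (phi w) <= (1 + C * rho) * N (u - w) /\
    N (u - w) <= (1 + C * rho) * d (phi u) (phi w)].
Proof.
have [C [r [C0 r0 rcod CP]]] := near_isometry d_metric d_top d_geo chart_at_cod.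
have sub u : x0 + u - x0 = u by rewrite addrAC subrr add0r.
exists C, r; split=> // [u ur|rho u w rr ur wr]; first by apply: rcod; rewrite sub.
have := CP rho (x0 + u) (x0 + w) rr; rewrite !sub => /(_ ur wr).
by rewrite (_ : x0 + u - (x0 + w) = u - w) // opprD addrACA subrr add0r.
Qed.

Lemma chart_ball (e : R) : 0 < e ->
  exists2 e', 0 < e' & forall y, d p y < e' -> dom i y /\ N (coord i y - x0) < e.
Proof.
move=> e0.
have dp : dom i p by exact: chart_atP.
have n1 : nbhs p (dom i) by apply: open_nbhs_nbhs; split=> //; exact: dom_open.
have n2 : nbhs p [set y | N (coord i y - x0) < e].
  have h : (fun y => N (coord i y - x0)) @ p --> N (x0 - x0).
    apply: (@cvg_comp _ _ _ (fun y => coord i y - x0) N (nbhs p) (nbhs (x0 - x0))).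
      by apply: cvgB; [exact: (Defs.coord_continuous dp) | exact: cvg_cst].
    exact: nrm_continuous.
  by apply: (cvgr_lt _ h); rewrite subrr nrm0.
by have [e' e'0 e'P] := (d_top p _).1 (filterI n1 n2); exists e' => // y /e'P.
Qed.

Variable f : M -> M.
Hypotheses (f_isom : forall x y, d (f x) (f y) = d x y) (fp : f p = p).

Let F (u : 'rV[R]_n) : 'rV[R]_n := coord i (f (phi u)) - x0.

Lemma isometry_chart : exists C r, [/\ 0 < C, 0 < r,
  forall u, N u < r -> f (phi u) = phi (F u) &
  forall rho u w, rho < r -> N u <= rho -> N w <= rho ->
    N (F u - F w) <= (1 + C * rho) * N (u - w) /\
    N (u - w) <= (1 + C * rho) * N (F u - F w)].
Proof.
have [C [r [C0 r0 rcod CP]]] := normal_point_near.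
have [e e0 eP] := chart_ball r0.
pose K := 1 + C * r.
have K1 : 1 <= K by rewrite lerDl mulr_ge0 // ltW.
have K0 : 0 < K by apply: lt_le_trans K1.
have dpu u : N u < r -> d p (phi u) <= K * N u.
  move=> ur; have [] := CP (N u) 0 u ur; rewrite ?nrm0 ?nrm_ge0 //.
  rewrite normal_point0 sub0r nrmN => h _; apply: le_trans h _.
  by rewrite ler_wpM2r ?nrm_ge0 // lerD2l ler_wpM2l // ltW.
(* The bound [e / K] keeps [f (phi u)] inside the chart, and [r / K ^+ 2] keeps [F u] in the ball
   where [CP] applies, because [N (F u) <= K ^+ 2 * N u]. *)
pose r1 := Num.min (r / K ^+ 2) (Num.min r (e / K)).
have r10 : 0 < r1 by rewrite !lt_min r0 !divr_gt0 ?exprn_gt0.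
have r1P u : N u < r1 -> [/\ N u < r, K ^+ 2 * N u < r, dom i (f (phi u)) & N (F u) < r].
  rewrite !lt_min => /and3P[h1 h2 h3]; split=> //.
  - by rewrite mulrC -ltr_pdivlMr // exprn_gt0.
  - have [|//] := eP (f (phi u)); rewrite -{1}fp f_isom.
    by apply: le_lt_trans (dpu u h2) _; rewrite mulrC -ltr_pdivlMr.
  have [|//] := eP (f (phi u)); rewrite -{1}fp f_isom.
  by apply: le_lt_trans (dpu u h2) _; rewrite mulrC -ltr_pdivlMr.
have fphi u : N u < r1 -> f (phi u) = phi (F u).
  by move=> /r1P[_ _ du _]; rewrite [RHS]/normal_point /F (addrC x0) subrK coordK.
have FK u : N u < r1 -> N (F u) <= K ^+ 2 * N u.
  move=> ur; have [ur' uK du Fur] := r1P u ur.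
  have N0F : N 0 <= N (F u) by rewrite nrm0 nrm_ge0.
  have [_] := CP (N (F u)) 0 (F u) Fur N0F (lexx _).
  rewrite normal_point0 sub0r nrmN -(fphi u ur) -{1}fp f_isom => h.
  apply: le_trans h _; rewrite expr2 -mulrA; apply: ler_pM.
  - by rewrite addr_ge0 // mulr_ge0 ?nrm_ge0 // ltW.
  - by case: d_metric.
  - by rewrite lerD2l ler_wpM2l ?(ltW C0) // ltW.
  exact: dpu.
(* Comparing through [d] on both sides of [f] gives $(1+CR')^2$ with $R'=K^2\rho$, and $R'^2\le rR'$
   makes the error linear in $\rho$. *)
exists ((2 * C + C ^+ 2 * r) * K ^+ 2), r1; split => //.
  by rewrite mulr_gt0 ?exprn_gt0 // addr_gt0 ?mulr_gt0 ?exprn_gt0.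
move=> rho u w rr ur wr.
have rho0 : 0 <= rho by apply: le_trans ur; exact: nrm_ge0.
have K21 : 1 <= K ^+ 2 by exact: exprn_ege1.
pose R' := K ^+ 2 * rho.
have R'r : R' < r.
  by move: rr; rewrite !lt_min => /andP[h _]; rewrite /R' mulrC -ltr_pdivlMr ?exprn_gt0.
have R'0 : 0 <= R' by rewrite mulr_ge0 // exprn_ge0 // ltW.
have rhoR' : rho <= R' by rewrite -[leLHS]mul1r ler_wpM2r.
have ur1 : N u < r1 by exact: le_lt_trans ur rr.
have wr1 : N w < r1 by exact: le_lt_trans wr rr.
have FuR : N (F u) <= R'.
  by apply: le_trans (FK u ur1) _; rewrite ler_wpM2l // exprn_ge0 // ltW.
have FwR : N (F w) <= R'.
  by apply: le_trans (FK w wr1) _; rewrite ler_wpM2l // exprn_ge0 // ltW.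
have [h1 h2] := CP R' u w R'r (le_trans ur rhoR') (le_trans wr rhoR').
have [h3 h4] := CP R' (F u) (F w) R'r FuR FwR.
rewrite -(fphi u ur1) -(fphi w wr1) f_isom in h3 h4.
have CR0 : 0 <= 1 + C * R' by rewrite addr_ge0 // mulr_ge0 // ltW.
have CRK : (1 + C * R') * (1 + C * R') <= 1 + (2 * C + C ^+ 2 * r) * K ^+ 2 * rho.
  have -> : (2 * C + C ^+ 2 * r) * K ^+ 2 * rho = 2 * C * R' + C ^+ 2 * (r * R').
    by rewrite /R'; ring.
  have -> : (1 + C * R') * (1 + C * R') = 1 + (2 * C * R' + C ^+ 2 * (R' * R')) by ring.
  by rewrite !lerD2l ler_wpM2l ?sqr_ge0 // ler_wpM2r // ltW.
split.
  apply: le_trans h4 _; apply: le_trans (_ : (1 + C * R') * ((1 + C * R') * N (u - w)) <= _).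
    by rewrite ler_wpM2l.
  by rewrite mulrA ler_wpM2r ?nrm_ge0.
apply: le_trans h2 _; apply: le_trans (_ : (1 + C * R') * ((1 + C * R') * N (F u - F w)) <= _).
  by rewrite ler_wpM2l.
by rewrite mulrA ler_wpM2r ?nrm_ge0.
Qed.

Theorem isometry_differential :
  (forall e, 0 < e -> exists2 r, 0 < r & forall u, N u < r ->
    f (phi u) = phi (F u) /\ N (F u - differential A f p u) <= e * N u) /\
  (forall a u, differential A f p (a *: u) = a *: differential A f p u).
Proof.
have [C [r [C0 r0 fphi FP]]] := isometry_chart.
have F0 : F 0 = 0 by rewrite /F normal_point0 fp subrr.
pose r2 := Num.min r (C^-1).
have r20 : 0 < r2 by rewrite lt_min r0 invr_gt0.
have Cr2 : C * r2 <= 1 by rewrite -ler_pdivlMl // mulr1 ge_min lexx orbT.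
pose D := 12 * (48 * C).
have D0 : 0 < D by rewrite /D !mulr_gt0.
have FP2 rho u w : rho < r2 -> N u <= rho -> N w <= rho ->
    N (F u - F w) <= (1 + C * rho) * N (u - w) /\
    N (u - w) <= (1 + C * rho) * N (F u - F w).
  by rewrite lt_min => /andP[h _]; exact: FP.
have [L Lc LF] := near_linear Ssym Spos C0 r20 F0 FP2 Cr2 (lexx D).
have oF e : 0 < e -> exists2 r', 0 < r' & forall u, N u < r' ->
    f (phi u) = phi (F u) /\ N (F u - L u) <= e * N u.
  (* $4\sqrt{DN^3}\le eN$ holds as soon as $16DN\le e^2$. *)
  move=> e0; exists (Num.min r2 (e ^+ 2 / (16 * D))).
    by rewrite lt_min r20 divr_gt0 ?exprn_gt0 // mulr_gt0.
  move=> u; rewrite lt_min => /andP[ur ue]; split.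
    by apply: fphi; move: ur; rewrite lt_min => /andP[].
  apply: le_trans (LF u ur) _.
  have N0 := nrm_ge0 S u.
  have eN : 0 <= e * N u by rewrite mulr_ge0 // ltW.
  have -> : e * N u = 4 * (e * N u / 4) by field.
  rewrite ler_wpM2l // -[leRHS]ger0_norm ?divr_ge0 // -sqrtr_sqr ler_wsqrtr //.
  have h : N u * (16 * D) <= e ^+ 2 by rewrite -ler_pdivlMr ?mulr_gt0 // ltW.
  have : N u ^+ 2 * (N u * (16 * D)) <= N u ^+ 2 * e ^+ 2 by rewrite ler_wpM2l // sqr_ge0.
  move: (D) => D' h'; have -> : (e * N u / 4) ^+ 2 = N u ^+ 2 * e ^+ 2 / 16 by field.
  by rewrite ler_pdivlMr //; apply: le_trans h'; rewrite le_eqVlt; apply/orP; left; apply/eqP; ring.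
have dE : differential A f p = L :> ('rV[R]_n -> 'rV[R]_n).
  rewrite /differential fp -/i -/x0.
  suff [_] : differentiable (coord i \o f \o param i) x0 /\
    'd (coord i \o f \o param i) x0 = L :> ('rV[R]_n -> 'rV[R]_n) by [].
  apply: diff_approx_unique => // e e0.
  have [c c0 cS] := norm_le_nrm Ssym Spos.
  have [k k0 kS] := nrm_le_norm Spos.
  (* Differentiability is measured in the ambient norm and the estimate in [N]; [c] and [k] pay for
     the two conversions. *)
  have e'0 : 0 < e / (c * k) by rewrite divr_gt0 ?mulr_gt0.
  have [r' r'0 r'P] := oF _ e'0.
  have hn : \forall h \near (0 : 'rV[R]_n), N h < r'.
    have h : N @ (0 : 'rV[R]_n) --> N 0 by exact: nrm_continuous.
    by apply: (cvgr_lt _ h); rewrite nrm0.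
  apply: filterS hn => h hr; have [_ hF] := r'P h hr.
  have -> : (coord i \o f \o param i) (h + x0) - (coord i \o f \o param i) x0 - L h = F h - L h.
    have e1 : (coord i \o f \o param i) x0 = x0.
      by have := normal_point0; rewrite /normal_point addr0 /= => ->; rewrite fp.
    have e2 : (coord i \o f \o param i) (h + x0) = coord i (f (phi h)).
      by rewrite /normal_point [x0 + h]addrC.
    by rewrite e1 e2.
  apply: le_trans (cS _) _; rewrite -ler_pdivlMl //; apply: le_trans hF _.
  have -> : e / (c * k) * N h = c^-1 * e * (k^-1 * N h) by rewrite invfM; ring.
  rewrite [leRHS]mulrA; apply: ler_wpM2l; first by rewrite mulr_ge0 ?invr_ge0 // ltW.
  by rewrite ler_pdivrMl.
by rewrite dE; split=> // a u; rewrite linearZ.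
Qed.

End Differential.

(** * Blow-up at a point *)

Section Blowup.
Context {R : realType} {n : nat} {M : topologicalType} {A : smooth_atlas R n M}.
Variables (g : riemannian_metric A) (d : M -> M -> R).
Hypotheses (d_metric : is_metric d) (d_top : induces_topology d)
  (d_geo : restricts_to_geodesic_dist g d).
Variable p : M.

Local Notation N := (nrm (gram g (chart_at A p) (coord (chart_at A p) p))).
Local Notation phi := (normal_point (A := A) p).
Local Notation hk k := ((k.+1%:R : R)^-1).

Lemma harmonic_lt (e : R) : 0 < e -> \forall k \near \oo, hk k < e.
Proof. by move=> e0; apply: (cvgr_lt _ (@cvg_harmonic R)). Qed.

Lemma blowup_approx (f : M -> M) (x : 'rV[R]_n) :
  (forall x y, d (f x) (f y) = d x y) -> f p = p ->
  exists2 F : 'rV[R]_n -> 'rV[R]_n,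
    \forall k \near \oo, f (phi (hk k *: x)) = phi (F (hk k *: x)) &
    forall e, 0 < e -> \forall k \near \oo,
      N (k.+1%:R *: F (hk k *: x) - differential A f p x) <= e.
Proof.
move=> f_isom fp.
have [oF LZ] := isometry_differential d_metric d_top d_geo f_isom fp.
have Nx0 := nrm_ge0 (gram g (chart_at A p) (coord (chart_at A p) p)) x.
have hx r : 0 < r -> \forall k \near \oo, N (hk k *: x) < r.
  move=> r0; have : 0 < r / (N x + 1) by rewrite divr_gt0 // ltr_wpDl.
  move=> /harmonic_lt; apply: filterS => k; rewrite ltr_pdivlMr ?ltr_wpDl // => h.
  rewrite nrmZ ger0_norm ?invr_ge0 //; apply: le_lt_trans h.
  by rewrite ler_wpM2l ?invr_ge0 // lerDl.
exists (fun u => coord (chart_at A p) (f (phi u)) - coord (chart_at A p) p).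
  have [r r0 rP] := oF 1 ltr01.
  by apply: filterS (hx r r0) => k /rP[].
move=> e e0; have e'0 : 0 < e / (N x + 1) by rewrite divr_gt0 // ltr_wpDl.
have [r r0 rP] := oF _ e'0.
apply: filterS (hx r r0) => k /rP[_].
set Fk := _ - coord _ p; rewrite LZ nrmZ ger0_norm ?invr_ge0 // => h.
have k0 : 0 < k.+1%:R :> R by rewrite ltr0n.
have -> : k.+1%:R *: Fk - differential A f p x =
    k.+1%:R *: (Fk - hk k *: differential A f p x).
  by rewrite [RHS]scalerBr scalerA divff ?scale1r // gt_eqF.
rewrite nrmZ gtr0_norm //; apply: (@le_trans _ _ (e / (N x + 1) * N x)).
  rewrite -ler_pdivlMl //; apply: le_trans h _.
  by rewrite mulrCA.
rewrite mulrAC ler_pdivrMr ?ltr_wpDl // ler_wpM2l ?(ltW e0) //.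
by rewrite lerDl.
Qed.

(** Two isometries appear because an orbit distance compares points moved by different stabilizer
    elements. At scale $1/(k+1)$, [d] and [N] agree up to a factor tending to 1, and a squeeze
    concludes. *)
Lemma blowup_dist (f1 f2 : M -> M) (x y : 'rV[R]_n) :
  (forall x y, d (f1 x) (f1 y) = d x y) -> f1 p = p ->
  (forall x y, d (f2 x) (f2 y) = d x y) -> f2 p = p ->
  (fun k => k.+1%:R * d (f1 (phi (hk k *: x))) (f2 (phi (hk k *: y)))) @ \oo -->
  N (differential A f1 p x - differential A f2 p y).
Proof.
move=> f1i f1p f2i f2p.
have [F1 phi1 lim1] := blowup_approx x f1i f1p.
have [F2 phi2 lim2] := blowup_approx y f2i f2p.
set u := differential A f1 p x; set v := differential A f2 p y.
rewrite -/u in lim1; rewrite -/v in lim2.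
have [C [r [C0 r0 _ CP]]] := normal_point_near d_metric d_top d_geo p.
have cd := chart_at_cod (A := A) p.
have Ssym := gram_sym g cd; have Spos := gram_posdef g cd.
have k0 k : 0 < k.+1%:R :> R by rewrite ltr0n.
have hk0 k : 0 < hk k by rewrite invr_gt0.
pose a k := k.+1%:R * N (F1 (hk k *: x) - F2 (hk k *: y)).
(* For large [k] both image points lie in the ball of radius [hk k * B]; the summand 1 absorbs the
   error of the two limits. *)
pose B := N u + N v + 1.
have B0 : 0 < B by rewrite ltr_wpDl // addr_ge0 ?nrm_ge0.
pose s k := 1 + C * B * hk k.
have s0 k : 0 < s k by rewrite ltr_wpDr // mulr_ge0 ?(ltW (hk0 _)) // mulr_ge0 // ltW.
have s_lim : s @ \oo --> (1 : R).
  rewrite -[X in _ --> X]addr0 -[X in _ --> _ + X](mulr0 (C * B)).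
  by apply: cvgD; [exact: cvg_cst | apply: cvgMl_tmp; exact: cvg_harmonic].
have a_lim : a @ \oo --> N (u - v).
  apply/cvgrPdist_le => e e0.
  have e2 : 0 < e / 2 by rewrite divr_gt0.
  near=> k.
  have -> : a k = N (k.+1%:R *: F1 (hk k *: x) - k.+1%:R *: F2 (hk k *: y)).
    by rewrite -scalerBr nrmZ gtr0_norm.
  rewrite distrC; apply: le_trans (nrmB_ge Ssym Spos _ _) _.
  have -> (p1 p2 : 'rV[R]_n) : p1 - p2 - (u - v) = (p1 - u) - (p2 - v).
    by rewrite !opprD !opprK addrACA.
  apply: le_trans (nrmD Ssym Spos _ _) _; rewrite nrmN [leRHS]splitr; apply: lerD.
    by near: k; exact: lim1.
  by near: k; exact: lim2.
have comp : \forall k \near \oo,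
    (s k)^-1 * a k <= k.+1%:R * d (f1 (phi (hk k *: x))) (f2 (phi (hk k *: y))) <= s k * a k.
  near=> k.
  have -> : f1 (phi (hk k *: x)) = phi (F1 (hk k *: x)) by near: k.
  have -> : f2 (phi (hk k *: y)) = phi (F2 (hk k *: y)) by near: k.
  have bnd (w z : 'rV[R]_n) : N (k.+1%:R *: w - z) <= 1 -> N w <= hk k * (N z + 1).
    move=> h; rewrite mulrC ler_pdivlMr //.
    have -> : N w * k.+1%:R = N (k.+1%:R *: w) by rewrite nrmZ gtr0_norm // mulrC.
    rewrite -(subrK z (k.+1%:R *: w)); apply: le_trans (nrmD Ssym Spos _ _) _.
    by rewrite addrC lerD2l.
  have b1 : N (F1 (hk k *: x)) <= hk k * B.
    apply: le_trans (bnd _ u _) _; first by near: k; exact: lim1.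
    by rewrite ler_wpM2l ?(ltW (hk0 _)) // /B lerD2r lerDl nrm_ge0.
  have b2 : N (F2 (hk k *: y)) <= hk k * B.
    apply: le_trans (bnd _ v _) _; first by near: k; exact: lim2.
    by rewrite ler_wpM2l ?(ltW (hk0 _)) // /B lerD2r lerDr nrm_ge0.
  have br : hk k * B < r.
    by rewrite -ltr_pdivlMr //; near: k; apply: harmonic_lt; rewrite divr_gt0.
  have [h1 h2] := CP _ _ _ br b1 b2.
  have sE : 1 + C * (hk k * B) = s k by rewrite /s; ring.
  rewrite sE in h1 h2; apply/andP; split.
    rewrite -ler_pdivlMl ?invr_gt0 // invrK /a mulrCA; apply: ler_wpM2l; first exact: ltW.
    exact: h2.
  by rewrite /a mulrCA; apply: ler_wpM2l; first exact: ltW.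
apply: (squeeze_cvgr comp).
  have h := cvgM (cvgV (oner_neq0 R) s_lim) a_lim.
  by rewrite invr1 mul1r in h; exact: h.
by have h := cvgM s_lim a_lim; rewrite mul1r in h; exact: h.
Unshelve. all: by end_near. Qed.

End Blowup.

(** * Orbit spaces and wandering actions *)

Lemma near_finite (T : choiceType) (A : set T) (U : Type) (F : set_system U)
    {FF : Filter F} (P : T -> U -> Prop) :
  finite_set A -> (forall a, A a -> \forall k \near F, P a k) ->
  \forall k \near F, forall a, A a -> P a k.
Proof.
move=> /finite_seqP[s ->]; elim: s => [|b s IH] Ps; first exact: filterE.
have h1 : \forall k \near F, P b k by apply: Ps; rewrite /= mem_head.
have h2 : \forall k \near F, forall a, [set` s] a -> P a k.
  by apply: IH => a sa; apply: Ps; rewrite /= in_cons sa orbT.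
apply: filterS2 h1 h2 => k Pb Pk a; rewrite /= in_cons => /orP[/eqP->//|]; exact: Pk.
Qed.

Lemma finite_lower (R : realType) (T : choiceType) (A : set T) (f : T -> R) :
  finite_set A -> exists2 m, 0 < m & forall a, A a -> 0 < f a -> m <= f a.
Proof.
move=> Afin; have h : \forall m \near (0 : R)^'+, forall a, A a -> 0 < f a -> m <= f a.
  apply: near_finite => // a _; have [fa|fa] := ltP 0 (f a); last exact: filterE.
  by near=> m => _; near: m; exact: nbhs_right_le.
near (0 : R)^'+ => m; exists m; first by near: m; exact: nbhs_right_gt.
by near: m.
Unshelve. all: by end_near. Qed.

Section Orbits.
Context {R : realType} {G X : Type} (S : set G) (act : G -> X -> X) (d : X -> X -> R).

Definition orb (x : X) : orbit_space S act :=
  exist _ (orbit_of S act x) (ex_intro _ x erefl).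

Lemma orb_surj (O : orbit_space S act) : exists x, O = orb x.
Proof.
by case: O => O [x xO]; exists x; apply: eq_exist.
Qed.

Lemma orb_eq (x y : X) : orbit_of S act x = orbit_of S act y -> orb x = orb y.
Proof. by move=> xy; apply: eq_exist. Qed.

Lemma qdist_ge (m : R) (x y : X) : S !=set0 ->
  (forall a b, S a -> S b -> m <= d (act a x) (act b y)) ->
  m <= quotient_dist d (orb x) (orb y).
Proof.
move=> [s Ss] h; apply: lb_le_inf.
  by exists (d (act s x) (act s y)); exists (act s x); [exists s | exists (act s y); [exists s|]].
by move=> _ [_ [a Sa <-]] [_ [b Sb <-]] <-; exact: h.
Qed.

Hypothesis d_ge0 : forall x y, 0 <= d x y.

Lemma qdist_le (a b : G) (x y : X) : S a -> S b ->
  quotient_dist d (orb x) (orb y) <= d (act a x) (act b y).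
Proof.
move=> Sa Sb; apply: ge_inf.
  by exists 0 => _ [u _] [v _] <-; exact: d_ge0.
by exists (act a x); [exists a | exists (act b y); [exists b|]].
Qed.

Lemma qdist_adherent (e : R) (x y : X) : S !=set0 -> 0 < e -> exists a b,
  [/\ S a, S b & d (act a x) (act b y) < quotient_dist d (orb x) (orb y) + e].
Proof.
move=> [s Ss] e0.
have := @inf_adherent R [set d u v | u in sval (orb x) & v in sval (orb y)] e e0.
case; last first.
  move=> _ [_ [a Sa <-]] [_ [b Sb <-]] <- h; exists a, b; split => //.
split; last by exists 0 => _ [u _] [v _] <-; exact: d_ge0.
by exists (d (act s x) (act s y)); exists (act s x); [exists s | exists (act s y); [exists s|]].
Qed.

End Orbits.

Section Actions.
Context {R : realType} {M : topologicalType} (d : M -> M -> R).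
Hypotheses (d_metric : is_metric d) (d_top : induces_topology d).
Variables (G : groupType) (act : G -> M -> M).
Hypotheses (act_action : is_group_action act) (act_isom : isometric_action d act)
  (act_wandering : wandering act).

(* If [c0 y] lies in a wandering neighborhood of [x], every [c y] in it is
   [c' c0 y] with [c'] in a finite set. *)
Lemma orbit_separation (x y : M) :
  exists2 m, 0 < m & forall c, act c y <> x -> m <= d x (act c y).
Proof.
have [d_ge0 d_eq0 d_sym d_tri] := d_metric; have [act1 actM] := act_action.
have [U [Uo Ux Afin]] := act_wandering x.
have [e e0 eU] := (d_top x U).1 (open_nbhs_nbhs (conj Uo Ux)).
have [[c0 c0U]|nU] := pselect (exists c, U (act c y)); last first.
  exists e => // c _; rewrite leNgt; apply/negP => h; apply: nU.
  by exists c; exact: eU.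
have [m m0 mP] := finite_lower (fun c => d x (act (c * c0)%g y)) Afin.
exists (Num.min e m); first by rewrite lt_min e0 m0.
move=> c cx; rewrite ge_min; have [//|cU] := leP e (d x (act c y)).
have cE : c = (c * c0^-1 * c0)%g by rewrite mulgVK.
rewrite [X in m <= d x (act X _)]cE mP ?orbT // -?cE.
  exists (act c y); split; last exact: eU.
  by exists (act c0 y) => //; rewrite -actM -cE.
rewrite lt_neqAle d_ge0 andbT eq_sym; apply/eqP => /d_eq0 h.
by apply: cx.
Qed.

Lemma stabilizer_finite (p : M) : finite_set (stabilizer act p).
Proof.
have [U [Uo Up Afin]] := act_wandering p.
apply: sub_finite_set Afin => a ap; exists p; split => //.
by exists p.
Qed.

Lemma orb_act (c : G) (y : M) : orb [set: G] act (act c y) = orb [set: G] act y.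
Proof.
have [act1 actM] := act_action.
apply: orb_eq; apply/seteqP; split=> z [a _ <-].
  by exists (a * c)%g.
by exists (a * c^-1)%g => //; rewrite -actM mulgVK.
Qed.

Lemma qdist_act_ge (m : R) (x y : M) : (forall c, m <= d x (act c y)) ->
  m <= quotient_dist d (orb [set: G] act x) (orb [set: G] act y).
Proof.
have [act1 actM] := act_action.
move=> h; apply: qdist_ge; first by exists 1%g.
move=> a b _ _; have := h (a^-1 * b)%g; rewrite actM -(act_isom a).
by rewrite -[act a (act a^-1 _)]actM mulgV act1.
Qed.

Lemma qdist_act_gt0 (x y : M) : orb [set: G] act x <> orb [set: G] act y ->
  0 < quotient_dist d (orb [set: G] act x) (orb [set: G] act y).
Proof.
move=> xy; have [m m0 mP] := orbit_separation x y.
apply: lt_le_trans m0 _; apply: qdist_act_ge => c; apply: mP => cyx.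
by apply: xy; rewrite -cyx orb_act.
Qed.

End Actions.

(** * The tangent quotient as a limit of rescaled orbit spaces *)

Section TangentQuotient.
Context {R : realType} {n : nat} {M : topologicalType} {A : smooth_atlas R n M}.
Variables (g : riemannian_metric A) (d : M -> M -> R).
Hypotheses (d_metric : is_metric d) (d_top : induces_topology d)
  (d_geo : restricts_to_geodesic_dist g d).
Variables (G : groupType) (act : G -> M -> M).
Hypotheses (act_action : is_group_action act) (act_isom : isometric_action d act)
  (act_wandering : wandering act).
Variable p : M.

Local Notation N := (nrm (gram g (chart_at A p) (coord (chart_at A p) p))).
Local Notation phi := (normal_point (A := A) p).
Local Notation hk k := ((k.+1%:R : R)^-1).
Local Notation L := (isotropy A act p).
Local Notation Gp := (stabilizer act p).
Local Notation orbT := (orb Gp L).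
Local Notation orbM := (orb [set: G] act).
Local Notation qT := (@quotient_dist R G 'rV[R]_n Gp L (tangent_dist g p)).
Local Notation qM := (@quotient_dist R G M [set: G] act d).

Let cd := chart_at_cod (A := A) p.
Let Ssym := gram_sym g cd.
Let Spos := gram_posdef g cd.

Lemma Gp1 : Gp 1%g. Proof. by case: act_action => a1 _; exact: a1. Qed.

Lemma GpM a b : Gp a -> Gp b -> Gp (a * b)%g.
Proof. by case: act_action => _ aM ap bp; rewrite /stabilizer /= aM bp. Qed.

Lemma GpV a : Gp a -> Gp a^-1%g.
Proof.
case: act_action => a1 aM ap; rewrite /stabilizer /= -{1}ap -aM mulVg; exact: a1.
Qed.

Lemma Gp_neq0 : Gp !=set0. Proof. by exists 1%g; exact: Gp1. Qed.

Lemma act_blowup a b (x y : 'rV[R]_n) : Gp a -> Gp b ->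
  (fun k => k.+1%:R * d (act a (phi (hk k *: x))) (act b (phi (hk k *: y)))) @ \oo -->
  N (L a x - L b y).
Proof.
move=> ap bp.
have h := blowup_dist d_metric d_top d_geo (act_isom a) ap (act_isom b) bp (x := x) (y := y).
exact: h.
Qed.

(** Both sides are limits of the same rescaled distances, as [act c] is an isometry. This stands in
    for the homomorphism property of the isotropy representation. *)
Lemma isotropy_dist_mul a b c (x y : 'rV[R]_n) : Gp a -> Gp b -> Gp c ->
  N (L (c * a)%g x - L (c * b)%g y) = N (L a x - L b y).
Proof.
move=> ap bp cp.
have h1 := act_blowup (x := x) (y := y) (GpM cp ap) (GpM cp bp).
have h2 := act_blowup (x := x) (y := y) ap bp.
have E : (fun k => k.+1%:R * d (act (c * a)%g (phi (hk k *: x))) (act (c * b)%g (phi (hk k *: y)))) =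
  (fun k => k.+1%:R * d (act a (phi (hk k *: x))) (act b (phi (hk k *: y)))).
  by apply/funext => k; case: act_action => _ aM; rewrite !aM act_isom.
rewrite E in h1.
exact: (cvg_unique (@norm_hausdorff R R^o) h1 h2).
Qed.

Lemma isotropy_orbit_sub a b (x y : 'rV[R]_n) : Gp a -> Gp b -> L a x = L b y ->
  orbit_of Gp L x `<=` orbit_of Gp L y.
Proof.
move=> ap bp ab z [c cp <-]; exists (c * a^-1 * b)%g.
  by apply: GpM => //; apply: GpM => //; exact: GpV.
have cap : Gp (c * a^-1)%g by apply: GpM => //; exact: GpV.
have := isotropy_dist_mul x y ap bp cap; rewrite ab subrr nrm0 mulgVK.
by move=> /(nrm_eq0 Spos)/eqP; rewrite subr_eq0 => /eqP.
Qed.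

Lemma tangent_qdist_gt0 (x y : 'rV[R]_n) : orbT x <> orbT y -> 0 < qT (orbT x) (orbT y).
Proof.
move=> xy.
have [m m0 mP] := finite_lower (fun c => N (L 1%g x - L c y))
  (stabilizer_finite act_wandering p).
apply: lt_le_trans m0 _; apply: qdist_ge; first exact: Gp_neq0.
move=> a b ap bp; have aVb : Gp (a^-1 * b)%g by apply: GpM => //; exact: GpV.
have := isotropy_dist_mul x y Gp1 aVb ap; rewrite mulg1 mulVKg /tangent_dist /tangent_norm.
rewrite -/(nrm _ _) => ->; apply: mP => //.
rewrite lt_neqAle nrm_ge0 andbT eq_sym; apply/eqP => /(nrm_eq0 Spos)/eqP.
rewrite subr_eq0 => /eqP xy'; apply: xy; apply: orb_eq; apply/seteqP; split.
  exact: (isotropy_orbit_sub Gp1 aVb xy').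
exact: (isotropy_orbit_sub aVb Gp1 (esym xy')).
Qed.

(** From above, one nearly optimal pair of stabilizer elements suffices. From below, the finitely
    many elements of [Gp] are handled together by [near_finite], and every other element is too far
    away to compete. *)
Lemma quotient_blowup (x y : 'rV[R]_n) :
  (fun k => k.+1%:R * qM (orbM (phi (hk k *: x))) (orbM (phi (hk k *: y)))) @ \oo -->
  qT (orbT x) (orbT y).
Proof.
have [d_ge0 d_eq0 d_sym d_tri] := d_metric.
have [act1 actM] := act_action.
have k0 k : 0 < k.+1%:R :> R by rewrite ltr0n.
have t_ge0 (u v : 'rV[R]_n) : 0 <= tangent_dist g p u v by exact: nrm_ge0.
set D := qT _ _; apply/cvgrPdist_le => e e0.
have upper : \forall k \near \oo,
    k.+1%:R * qM (orbM (phi (hk k *: x))) (orbM (phi (hk k *: y))) <= D + e.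
  have [a [b [ap bp abD]]] := @qdist_adherent R G _ Gp L _ t_ge0 e x y Gp_neq0 e0.
  have : \forall k \near \oo,
      k.+1%:R * d (act a (phi (hk k *: x))) (act b (phi (hk k *: y))) < D + e.
    by apply: (cvgr_lt _ (act_blowup (x := x) (y := y) ap bp)); exact: abD.
  apply: filterS => k hlt; apply: le_trans (ltW hlt).
  by rewrite ler_wpM2l ?(ltW (k0 k)) //; apply: qdist_le.
have [m m0 mP] := orbit_separation d_metric d_top act_action act_wandering p p.
have bounded (z : 'rV[R]_n) : exists B, \forall k \near \oo,
    k.+1%:R * d p (phi (hk k *: z)) <= B.
  exists (N (L 1%g 0 - L 1%g z) + 1).
  have h : N (L 1%g 0 - L 1%g z) < N (L 1%g 0 - L 1%g z) + 1 by rewrite ltrDl.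
  have : \forall k \near \oo,
      k.+1%:R * d (act 1%g (phi (hk k *: 0))) (act 1%g (phi (hk k *: z))) <
      N (L 1%g 0 - L 1%g z) + 1.
    by apply: (cvgr_lt _ (act_blowup (x := 0) (y := z) Gp1 Gp1)); exact: h.
  by apply: filterS => k /ltW; rewrite !act1 scaler0 normal_point0.
have [Bx hBx] := bounded x; have [By hBy] := bounded y.
have fin : \forall k \near \oo, forall c, Gp c ->
    D - e <= k.+1%:R * d (phi (hk k *: x)) (act c (phi (hk k *: y))).
  apply: near_finite; first exact: stabilizer_finite.
  move=> c cp; have h : D - e < N (L 1%g x - L c y).
    apply: lt_le_trans (@qdist_le R G _ Gp L _ t_ge0 _ _ x y Gp1 cp).
    by rewrite ltrBlDr ltrDl.
  have : \forall k \near \oo,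
      D - e < k.+1%:R * d (act 1%g (phi (hk k *: x))) (act c (phi (hk k *: y))).
    by apply: (cvgr_gt _ (act_blowup (x := x) (y := y) Gp1 cp)); exact: h.
  by apply: filterS => k /ltW; rewrite act1.
have lower : \forall k \near \oo,
    D - e <= k.+1%:R * qM (orbM (phi (hk k *: x))) (orbM (phi (hk k *: y))).
  near=> k; rewrite mulrC -ler_pdivrMr //; apply: qdist_act_ge => // c.
  rewrite ler_pdivrMr // mulrC.
  have [cp|ncp] := pselect (Gp c); first by move: c cp; near: k.
  have h := mP c ncp.
  have hx : k.+1%:R * d p (phi (hk k *: x)) <= Bx by near: k.
  have hy : k.+1%:R * d p (phi (hk k *: y)) <= By by near: k.
  (* An element outside [Gp] moves [p] by at least [m]. After rescaling this outgrows the bounded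
     distances of the two points from [p], leaving at least [D] between them. *)
  have hm : D + Bx + By <= k.+1%:R * m.
    rewrite -ler_pdivrMr //; apply: (@le_trans _ _ k%:R); last by rewrite ler_nat.
    by near: k; exact: nbhs_infty_ger.
  have tri : m <= d p (phi (hk k *: x)) + d (phi (hk k *: x)) (act c (phi (hk k *: y)))
      + d p (phi (hk k *: y)).
    apply: le_trans h _; apply: le_trans (d_tri _ (act c (phi (hk k *: y))) _) _.
    by rewrite act_isom (d_sym (phi (hk k *: y)) p) lerD2r.
  have := ler_wpM2l (ltW (k0 k)) tri; rewrite !mulrDr; lra.
near=> k; rewrite distrC ler_norml.
have h1 : k.+1%:R * qM (orbM (phi (hk k *: x))) (orbM (phi (hk k *: y))) <= D + e by near: k.
have h2 : D - e <= k.+1%:R * qM (orbM (phi (hk k *: x))) (orbM (phi (hk k *: y))) by near: k.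
by apply/andP; split; lra.
Unshelve. all: by end_near. Qed.

End TangentQuotient.

(** * Distortion *)

(** Sending [x0] to 0 bounds each sequence [f k x] through the convergent distances [q k x x0], so
    it defines a point of the ultraproduct; both inequalities are closed and pass to the limit. *)
Lemma ultraprod_embedding (R : realType) (H : completeNormedModType R) (X : Type)
    (dX : X -> X -> R) (q : nat -> X -> X -> R) (f : nat -> X -> H) (x0 : X) (a b : R) :
  (forall x y, q ^~ x ^~ y @ \oo --> dX x y) ->
  (forall k, f k x0 = 0) ->
  (forall k x y, a * q k x y <= `|f k x - f k y| <= b * q k x y) ->
  exists F : X -> ultraprod (H := H), forall x y,
    a * dX x y <= `|F x - F y| <= b * dX x y.
Proof.
move=> q_lim f0 fq.
have bounded x : (fun k => f k x) \in bounded_seq (H := H).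
  have [C [_ CP]] := cvg_seq_bounded (cvgP _ (q_lim x x0)).
  have qC k : `|q k x x0| <= C + 1 by apply: CP => //; rewrite ltrDl.
  apply/asboolP; exists (`|b| * (C + 1)) => k; rewrite -[f k x]subr0 -{1}(f0 k).
  have /andP[_ h] := fq k x x0; apply: le_trans h _; apply: le_trans (ler_norm _) _.
  by rewrite normrM ler_wpM2l.
exists (fun x => upi (BSeq (bounded x))) => x y.
rewrite -upiB norm_upi; have lim := @cvg_unorm R H (BSeq (bounded x) - BSeq (bounded y)).
have qlim := cvg_ultra_oo (q_lim x y).
apply/andP; split.
  apply: (ler_cvg_to (cvgMl_tmp qlim) lim); apply: filterE => k /=.
  by have /andP[] := fq k x y.
apply: (ler_cvg_to lim (cvgMl_tmp qlim)); apply: filterE => k /=.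
by have /andP[] := fq k x y.
Qed.

Section Distortion.
Context {R : realType} {X Y : Type} (dX : X -> X -> R) (dY : Y -> Y -> R).
Hypotheses (dX_ge0 : forall x x', 0 <= dX x x') (dY_ge0 : forall y y', 0 <= dY y y').
Hypothesis dX_pos : exists x x', 0 < dX x x'.
Local Open Scope ereal_scope.

Lemma ereal_le_div (c : \bar R) (D e : R) : (0 < D)%R ->
  (c * D%:E <= e%:E) = (c <= (e / D)%:E).
Proof.
move=> D0; case: c => [c||].
- by rewrite -EFinM !lee_fin ler_pdivlMr.
- by rewrite gt0_mulye ?lte_fin.
by rewrite gt0_mulNye ?lte_fin // !leNye.
Qed.

Lemma ereal_ge_div (c : \bar R) (D e : R) : (0 < D)%R ->
  (e%:E <= c * D%:E) = ((e / D)%:E <= c).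
Proof.
move=> D0; case: c => [c||].
- by rewrite -EFinM !lee_fin ler_pdivrMr.
- by rewrite gt0_mulye ?lte_fin // !leey.
by rewrite gt0_mulNye ?lte_fin.
Qed.

Lemma distortion_le (f : X -> Y) (a b : R) : (0 < a)%R ->
  (forall x x', a * dX x x' <= dY (f x) (f x') <= b * dX x x')%R ->
  distortion dX dY f <= (b / a)%:E.
Proof.
move=> a0 fab; have [x [x' xx']] := dX_pos.
have ab : (a <= b)%R.
  by have /andP[h1 h2] := fab x x'; have := le_trans h1 h2; rewrite ler_pM2r.
have la : a%:E <= lower_lipschitz dX dY f.
  apply: ereal_sup_ubound; split; first by rewrite lee_fin ltW.
  by move=> y y'; rewrite -EFinM lee_fin; case/andP: (fab y y').
have lb : lower_lipschitz dX dY f <= b%:E.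
  apply: ge_ereal_sup => c [_ /(_ x x')]; rewrite ereal_le_div //.
  move=> /le_trans; apply; rewrite lee_fin ler_pdivrMr //; by case/andP: (fab x x').
have ub : upper_lipschitz dX dY f <= b%:E.
  apply: ereal_inf_lbound; split; first by rewrite lee_fin (le_trans (ltW a0)).
  by move=> y y'; rewrite -EFinM lee_fin; case/andP: (fab y y').
have u0 : 0 <= upper_lipschitz dX dY f by apply: le_ereal_inf_tmp => c [].
rewrite /distortion; move: la lb ub u0.
case: (lower_lipschitz dX dY f) => [l||]; rewrite ?leye_eq ?leeNy_eq //.
case: (upper_lipschitz dX dY f) => [u||]; rewrite ?leye_eq ?leeNy_eq //.
rewrite !lee_fin => la lb ub u0.
have l0 : (0 < l)%R by exact: lt_le_trans la.
rewrite eqe gt_eqF //= inver gt_eqF // -EFinM lee_fin.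
by apply: ler_pM => //; rewrite ?invr_ge0 ?(ltW l0) // lef_pV2 ?posrE.
Qed.

Lemma distortion_bounds (f : X -> Y) : distortion dX dY f != +oo ->
  exists a b : R, [/\ (0 < a)%R, (a <= b)%R,
    (forall x x', a * dX x x' <= dY (f x) (f x') <= b * dX x x')%R &
    distortion dX dY f = (b / a)%:E].
Proof.
have [x [x' xx']] := dX_pos.
have l0 : 0 <= lower_lipschitz dX dY f.
  apply: ereal_sup_ubound; split => // y y'; rewrite mul0e lee_fin; exact: dY_ge0.
have u0 : 0 <= upper_lipschitz dX dY f by apply: le_ereal_inf_tmp => c [].
have lP y y' : (0 < dX y y')%R ->
    lower_lipschitz dX dY f <= (dY (f y) (f y') / dX y y')%:E.
  by move=> D0; apply: ge_ereal_sup => c [_ /(_ y y')]; rewrite ereal_le_div.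
have uP y y' : (0 < dX y y')%R ->
    (dY (f y) (f y') / dX y y')%:E <= upper_lipschitz dX dY f.
  by move=> D0; apply: le_ereal_inf_tmp => c [_ /(_ y y')]; rewrite ereal_ge_div.
(* [dX] may vanish on distinct points, where quotients of distances say nothing; a finite upper
   constant still forces [dY] to vanish there. *)
have uZ y y' : dX y y' = 0%R -> upper_lipschitz dX dY f < +oo -> dY (f y) (f y') = 0%R.
  move=> D0 /ereal_inf_lt[c [_ /(_ y y')]]; rewrite D0 mule0 lee_fin => h _.
  by apply/eqP; rewrite eq_le h dY_ge0.
have := lP x x' xx'; have := uP x x' xx'.
rewrite /distortion; move: l0 u0 lP uP uZ.
case: (lower_lipschitz dX dY f) => [l||]; rewrite ?leye_eq ?leeNy_eq //.
case: (upper_lipschitz dX dY f) => [u||]; rewrite ?leye_eq ?leeNy_eq ?orbT ?eqxx //.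
rewrite !lee_fin eqe orbF => l0 u0 lP uP uZ lx ux.
have [_|lneq0] := eqVneq l 0%R; first by rewrite eqxx.
have {}l0 : (0 < l)%R by rewrite lt_neqAle eq_sym lneq0.
move=> _.
exists l, u; split=> //; first exact: le_trans lx.
  move=> y y'; have := dX_ge0 y y'; rewrite le_eqVlt => /predU1P[/esym D0|D0].
    by rewrite (uZ _ _ D0 (ltry u)) D0 !mulr0 lexx.
  have := lP y y' D0; have := uP y y' D0; rewrite !lee_fin.
  by rewrite ler_pdivrMr // ler_pdivlMr // => -> ->.
by rewrite inver gt_eqF.
Qed.

End Distortion.

(** This settles the case of a one-point tangent quotient, whose distortion is 1 by convention. *)
Lemma euclidean_distortion_ge1 (R : realType) (X : Type) (d : X -> X -> R) :
  (forall x y, 0 <= d x y) -> (forall x y, x <> y -> 0 < d x y) ->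
  (1 <= euclidean_distortion d)%E.
Proof.
move=> d_ge0 d_pos; rewrite /euclidean_distortion; case: asboolP => // X2.
apply: le_ereal_inf_tmp => c [H [f [_ <-]]].
have [->|] := eqVneq (distortion d (fun u v : H => `|u - v|) f) +oo%E; first exact: leey.
have ex : exists x y, 0 < d x y.
  move/existsNP: X2 => [x /existsNP[y xy]]; exists x, y; exact: d_pos.
move=> /(distortion_bounds d_ge0 (fun u v : H => normr_ge0 (u - v)) ex).
move=> [a [b [a0 ab _ ->]]]; rewrite lee_fin ler_pdivlMr // mul1r; exact: ab.
Qed.

Theorem theorem13 (R : realType) (n : nat) (M : topologicalType)
    (A : smooth_atlas R n M) (g : riemannian_metric A) (d : M -> M -> R)
    (d_metric : is_metric d) (d_top : induces_topology d)
    (d_geo : restricts_to_geodesic_dist g d)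
    (G : groupType) (act : G -> M -> M) (act_action : is_group_action act)
    (act_isom : isometric_action d act) (act_wandering : wandering act)
    (p : M) :
  (euclidean_distortion
     (@quotient_dist R G 'rV[R]_n (stabilizer act p) (isotropy A act p)
        (tangent_dist g p))
   <= euclidean_distortion (@quotient_dist R G M [set: G] act d))%E.
Proof.
have d_ge0 : forall x y, 0 <= d x y by case: d_metric.
set qT := quotient_dist (tangent_dist g p).
set qM := quotient_dist d.
have tangent_ge0 (u v : 'rV[R]_n) : 0 <= tangent_dist g p u v by exact: nrm_ge0.
have qT_ge0 O P : 0 <= qT O P.
  have [x ->] := orb_surj O; have [y ->] := orb_surj P.
  by apply: qdist_ge; [exact: Gp_neq0 | move=> a b _ _; exact: tangent_ge0].
have qM_ge0 O P : 0 <= qM O P.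
  have [x ->] := orb_surj O; have [y ->] := orb_surj P.
  by apply: qdist_ge; [exists 1%g | move=> a b _ _; exact: d_ge0].
have qM_pos O P : O <> P -> 0 < qM O P.
  have [x ->] := orb_surj O; have [y ->] := orb_surj P.
  exact: qdist_act_gt0.
rewrite {1}/euclidean_distortion; case: asboolP => T2.
  exact: euclidean_distortion_ge1.
have T_pos : exists O P, 0 < qT O P.
  move/existsNP: T2 => [Q /existsNP[P QP]]; exists Q, P; move: QP.
  have [x ->] := orb_surj Q; have [y ->] := orb_surj P.
  exact: (tangent_qdist_gt0 d_metric d_top d_geo).
(* An arbitrary representative is chosen in each tangent orbit. At a given [k] the point of [M/G]
   may depend on this choice, but the limit in [q_lim] does not. *)
pose phi k (O : orbit_space (stabilizer act p) (isotropy A act p)) := orb [set: G] act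
  (normal_point (A := A) p (k.+1%:R^-1 *: sval (cid (orb_surj O)))).
pose q k O P := k.+1%:R * qM (phi k O) (phi k P).
have q_lim O P : q ^~ O ^~ P @ \oo --> qT O P.
  rewrite [X in qT X _](svalP (cid (orb_surj O))) [X in qT _ X](svalP (cid (orb_surj P))).
  exact: (quotient_blowup d_metric d_top d_geo).
(* A positive limit has positive terms, so the orbit space of [M] is not a point either. *)
have M_pos : exists O P, 0 < qM O P.
  have [Q [P QP]] := T_pos.
  have [k _ /(_ k (leqnn k))] : \forall k \near \oo, 0 < q k Q P.
    by apply: (cvgr_gt _ (q_lim Q P)).
  by rewrite /q pmulr_rgt0 ?ltr0n // => h; eexists; eexists; exact: h.
rewrite /euclidean_distortion; case: asboolP => [M1|_].
  have [Q [P]] := M_pos; rewrite (M1 Q P).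
  have [x ->] := orb_surj P; rewrite ltNge => /negP[].
  have := @qdist_le R G M [set: G] act d d_ge0 1%g 1%g x x I I.
  by move=> h; apply: le_trans h _; case: d_metric => _ /(_ (act 1%g x) (act 1%g x))[_ ->].
apply: le_ereal_inf_tmp => c [H [f [Hh <-]]].
have [->|] := eqVneq (distortion qM (fun u v : H => `|u - v|) f) +oo%E; first exact: leey.
move=> /(distortion_bounds qM_ge0 (fun u v : H => normr_ge0 (u - v)) M_pos).
move=> [a [b [a0 ab fab ->]]].
(* Multiplying [f] and the distance by the same factor keeps [a] and [b]; subtracting the value at
   the orbit of 0 provides the required base point. *)
have [|k O P|F FP] := @ultraprod_embedding R H _ qT q
  (fun k O => k.+1%:R *: (f (phi k O) - f (phi k (orb _ _ 0)))) (orb _ _ 0) a b q_lim.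
- by move=> k; rewrite subrr scaler0.
- rewrite -scalerBr opprB addrA subrK normrZ ger0_norm // /q !(mulrCA _ k.+1%:R).
  by rewrite !ler_pM2l ?ltr0n //; exact: fab.
apply: (@le_trans _ _ (distortion qT (fun u v : ultraprod (H := H) => `|u - v|) F)).
  apply: ereal_inf_lbound; exists (ultraprod (H := H)), F; split => //.
  exact: ultraprod_hilbert.
exact: distortion_le.
Qed.
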